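(* Let $F$ be a field with a (surjective) valuation $v:F^\times\to\Gamma$ and corresponding residue field $k$. Then there is a surjective $R_F$-module homomorphism $S_v:\mathcal{RP}(F)\to \widehat{\mathcal{RP}}(k)_F$ such that $$S_v([a])=\begin{cases}1\otimes[\bar a], & v(a)=0,\\ 1\otimes C_k, & v(a)>0,\\ -(1\otimes C_k), & v(a)<0,\end{cases}$$ for $a\in F^\times$, where $\bar a$ denotes the image of $a$ in $k$.
   Context: For a field $F$ let $G_F=F^\times/(F^\times)^2$, let $\langle x\rangle\in G_F$ be the square class of $x\in F^\times$, $R_F=\mathbb{Z}[G_F]$, and $\langle\langle x\rangle\rangle=\langle x\rangle-1\in R_F$. Refined pre-Bloch group: if $|F|\ge 4$, $\mathcal{RP}(F)$ is the $R_F$-module with generators $[x]$, $x\in F^\times$, subject to $[1]=0$ and, for all $x,y\in F^\times\setminus\{1\}$, $0=[x]-[y]+\langle x\rangle[y/x]-\langle x^{-1}-1\rangle\left[\frac{1-x^{-1}}{1-y^{-1}}\right]+\langle 1-x\rangle\left[\frac{1-x}{1-y}\right]$. $\mathcal{RP}(\mathbb{F}_2)$ is an additive group of order $3$ with distinguished generator $C_{\mathbb{F}_2}$ (and $[1]=0$). $\mathcal{RP}(\mathbb{F}_3)$ is the $R_{\mathbb{F}_3}$-module generated by $[-1]$ with the single relation $2([-1]+\langle -1\rangle[-1])=0$ (and $[1]=0$). For $x\in F^\times$: $\psi_1(x)=[x]+\langle -1\rangle[x^{-1}]$; $\psi_2(x)=\langle 1-x\rangle(\langle x\rangle[x]+[x^{-1}])$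 if $x\neq 1$ and $\psi_2(1)=0$. (For $\mathbb{F}_2$, $\psi_1(1)=\psi_2(1)=0$; for $\mathbb{F}_3$, $\psi_1(-1)=\psi_2(-1)=[-1]+\langle -1\rangle[-1]$.) For $i=1,2$, $\mathcal{K}^{(i)}_F$ is the $R_F$-submodule of $\mathcal{RP}(F)$ generated by all $\psi_i(x)$, $x\in F^\times$, and $\widehat{\mathcal{RP}}(F)=\mathcal{RP}(F)/(\mathcal{K}^{(1)}_F+\mathcal{K}^{(2)}_F)$. For $|F|\ge4$ the element $C_F:=[x]+\langle -1\rangle[1-x]+\langle\langle 1-x\rangle\rangle\psi_1(x)\in\mathcal{RP}(F)$ does not depend on $x\in F\setminus\{0,1\}$; $C_{\mathbb{F}_2}$ is the distinguished generator and $C_{\mathbb{F}_3}=\psi_1(-1)$. Valuations $v:F^\times\to\Gamma$ take values in an ordered abelian group $\Gamma$ (written additively) and are always assumed surjective. $U=\{x\in F^\times: v(x)=0\}$ is the group of units of the valuation ring. The reduction map $U\to k^\times$ induces a ring homomorphism $\mathbb{Z}[U/U^2]\to R_k$, and $U/U^2\subset G_F$ gives $\mathbb{Z}[U/U^2]\subset R_F$. For an $R_k$-module $M$, $M_F:=R_F\otimes_{\mathbb{Z}[U/U^2]}M$, an $R_F$-module. *)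

(* Defs.v *)
From HB Require Import structures.
From mathcomp.multinomials Require Import monalg.
From mathcomp Require Import all_boot all_order all_algebra.
From mathcomp Require Import generic_quotient ring_quotient finmap.
From mathcomp Require Import boolp classical_sets cardinality.

Set Implicit Arguments.
Unset Strict Implicit.
Unset Printing Implicit Defensive.

Import Order.TTheory GRing.Theory Num.Theory.

Local Open Scope classical_set_scope.
Local Open Scope ring_scope.
Local Open Scope quotient_scope.

HB.mixin Record Group_isComGroup A of Group A := {
  mulgC : commutative ( *%g : A -> A -> A)
}.

#[short(type="comGroupType")]
HB.structure Definition ComGroup := {A of Group_isComGroup A & Group A}.

Section SquareClasses.
Context (A : comGroupType).

Definition sq_eqv (x y : A) : bool := `[< exists z : A, x = (y * z ^+ 2)%g >].

Lemma sq_eqv_equiv : equiv_class_of sq_eqv.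
Proof.
split=> [x|x y|y x z].
- by apply/asboolP; exists 1%g; rewrite expg1n mulg1.
- have sym u w : sq_eqv u w -> sq_eqv w u.
    move=> /asboolP[z ->]; apply/asboolP; exists (z^-1)%g.
    by rewrite expVgn mulgK.
  by apply/idP/idP; apply: sym.
- move=> /asboolP[s ->] /asboolP[t ->]; apply/asboolP; exists (t * s)%g.
  by rewrite expgMn ?mulgA //; apply: mulgC.
Qed.

Canonical sq_eqv_rel := EquivRelPack sq_eqv_equiv.
Canonical sq_eqv_encModRel := defaultEncModRel sq_eqv.

Definition sqclass := {eq_quot sq_eqv}.
HB.instance Definition _ := EqQuotient.on sqclass.
HB.instance Definition _ := Choice.on sqclass.

Definition sqc (x : A) : sqclass := \pi x.

Lemma sqcP (x y : A) : sqc x = sqc y <-> exists z, x = (y * z ^+ 2)%g.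
Proof.
split=> [/eqP|h]; first by rewrite eqmodE => /asboolP.
by apply/eqP; rewrite eqmodE; apply/asboolP.
Qed.

Definition sqc_mul (s t : sqclass) : sqclass := sqc (repr s * repr t)%g.
Definition sqc_inv (s : sqclass) : sqclass := sqc (repr s)^-1%g.

Lemma sqc_repr s : sqc (repr s) = s.
Proof. exact: reprK. Qed.

Lemma sqc_ind (P : sqclass -> Prop) : (forall x, P (sqc x)) -> forall s, P s.
Proof. by move=> h s; rewrite -[s]sqc_repr. Qed.

Lemma repr_sqc (x : A) : exists z, repr (sqc x) = (x * z ^+ 2)%g.
Proof. by apply/sqcP; rewrite sqc_repr. Qed.

Lemma sqc_mulE (x y : A) : sqc_mul (sqc x) (sqc y) = sqc (x * y)%g.
Proof.
apply/sqcP; have [z ->] := repr_sqc x; have [t ->] := repr_sqc y.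
exists (z * t)%g; rewrite expgMn; last exact: mulgC.
move: (z ^+ 2)%g (t ^+ 2)%g => a b.
by rewrite -!mulgA (mulgA a) (mulgC a) !mulgA.
Qed.

Lemma sqc_invE (x : A) : sqc_inv (sqc x) = sqc x^-1%g.
Proof.
apply/sqcP; have [z ->] := repr_sqc x; exists (z^-1)%g.
by rewrite invgM expVgn mulgC.
Qed.

Lemma sqc_mulA : associative sqc_mul.
Proof.
by elim/sqc_ind=> x; elim/sqc_ind=> y; elim/sqc_ind=> z; rewrite !sqc_mulE mulgA.
Qed.

Lemma sqc_mulC : commutative sqc_mul.
Proof. by elim/sqc_ind=> x; elim/sqc_ind=> y; rewrite !sqc_mulE mulgC. Qed.

Lemma sqc_mul1 : left_id (sqc 1%g) sqc_mul.
Proof. by elim/sqc_ind=> x; rewrite sqc_mulE mul1g. Qed.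

Lemma sqc_mulV : left_inverse (sqc 1%g) sqc_inv sqc_mul.
Proof. by elim/sqc_ind=> x; rewrite sqc_invE sqc_mulE mulVg. Qed.

Lemma sqc_1mul : right_id (sqc 1%g) sqc_mul.
Proof. by move=> s; rewrite sqc_mulC sqc_mul1. Qed.

Lemma sqc_Vmul : right_inverse (sqc 1%g) sqc_inv sqc_mul.
Proof. by move=> s; rewrite sqc_mulC sqc_mulV. Qed.

HB.instance Definition _ := isGroup.Build sqclass
  sqc_mulA sqc_mul1 sqc_1mul sqc_mulV sqc_Vmul.
HB.instance Definition _ := Group_isComGroup.Build sqclass sqc_mulC.

Lemma sqcM (x y : A) : sqc (x * y)%g = (sqc x * sqc y)%g.
Proof. by rewrite -sqc_mulE. Qed.

Lemma sqc1 : sqc 1%g = 1%g. Proof. by []. Qed.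

Lemma sqc_sqr (x : A) : sqc (x ^+ 2)%g = 1%g.
Proof. by rewrite -sqc1; apply/sqcP; exists x; rewrite mul1g. Qed.

End SquareClasses.

Section SquareClassMap.
Context (A B : comGroupType) (f : UMagmaMorphism.type A B).

Definition sqc_map (s : sqclass A) : sqclass B := sqc (f (repr s)).

Lemma sqc_mapE (x : A) : sqc_map (sqc x) = sqc (f x).
Proof.
apply/sqcP; have [z ->] := repr_sqc x; exists (f z).
by rewrite !gmulfM.
Qed.

Fact sqc_map_is_monoid_morphism : monoid.monoid_morphism sqc_map.
Proof.
split=> [|s t]; first by rewrite -sqc1 sqc_mapE gmulf1.
elim/sqc_ind: s => x; elim/sqc_ind: t => y.
by rewrite -sqcM !sqc_mapE gmulfM sqcM.
Qed.

HB.instance Definition _ :=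
  isUMagmaMorphism.Build (sqclass A) (sqclass B) sqc_map
    sqc_map_is_monoid_morphism.

End SquareClassMap.

(* {malg R[X]} is the free R-module on X, with basis << x >>; flin f is the
   R-linear map out of it with << x >> |-> f x. *)
Section FreeModule.
Context (R : nzRingType) (X : choiceType) (V : lmodType R) (f : X -> V).

Definition flin (g : {malg R[X]}) : V := \sum_(x <- msupp g) g@_x *: f x.

Lemma flinEw (g : {malg R[X]}) (d : {fset X}) : (msupp g `<=` d)%fset ->
  flin g = \sum_(x <- d) g@_x *: f x.
Proof.
move=> sgd; rewrite /flin (big_fset_incl _ sgd) // => x _ xg.
by rewrite mcoeff_outdom // scale0r.
Qed.

Fact flin_is_linear : linear flin.
Proof.
move=> a g h.
set d := (msupp g `|` msupp h `|` msupp (a *: g + h))%fset.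
have sd : (msupp (a *: g + h) `<=` d)%fset by exact: fsubsetUr.
have sg : (msupp g `<=` d)%fset by rewrite /d -fsetUA; exact: fsubsetUl.
have sh : (msupp h `<=` d)%fset by rewrite /d fsetUAC; exact: fsubsetUr.
rewrite (flinEw sd) (flinEw sg) (flinEw sh).
rewrite scaler_sumr -big_split /=; apply: eq_bigr => x _.
by rewrite mcoeffD mcoeffZ scalerDl scalerA.
Qed.

HB.instance Definition _ := GRing.isLinear.Build R {malg R[X]} V *:%R flin
  flin_is_linear.

Lemma flinU c x : flin << c *g x >> = c *: f x.
Proof. by rewrite (flinEw msuppU_le) big_seq_fset1 mcoeffUU. Qed.

End FreeModule.

Lemma malg_ind (R : nzRingType) (X : choiceType) (P : {malg R[X]} -> Prop) :
  P 0 -> (forall c x, P << c *g x >>) -> (forall g h, P g -> P h -> P (g + h)) ->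
  forall g, P g.
Proof.
by move=> P0 PU PD g; rewrite [g]monalgE; elim/big_ind: _.
Qed.

Lemma malgZU (R : nzRingType) (X : choiceType) (c d : R) (x : X) :
  c *: << d *g x >> = << c * d *g x >> :> {malg R[X]}.
Proof. by apply/malgP=> y; rewrite mcoeffZ !mcoeffU mulrnAr. Qed.

Definition grpring (A : comGroupType) : Type := {malg int[A]}.

Section GroupRing.
Context (A : comGroupType).
Implicit Types (x y z : grpring A).

HB.instance Definition _ := GRing.Lmodule.on (grpring A).

Definition gr_elt (a : A) : grpring A := << a >>.

Definition gr_mul x y : grpring A :=
  flin (fun a => flin (fun b => << (a * b)%g >> : {malg int[A]}) y) x.

Lemma gr_mulDl : left_distributive gr_mul +%R.
Proof. by move=> x y z; rewrite /gr_mul raddfD. Qed.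

Lemma gr_mulDr : right_distributive gr_mul +%R.
Proof.
move=> x y z; rewrite /gr_mul /flin -big_split /=; apply: eq_bigr => a _.
by rewrite -scalerDr -!/(flin _ _) raddfD.
Qed.

Lemma gr_mulUU c d (a b : A) :
  gr_mul << c *g a >> << d *g b >> = << c * d *g (a * b)%g >>.
Proof. by rewrite /gr_mul !flinU !malgZU mulr1. Qed.

Lemma gr_mul0r x : gr_mul 0 x = 0.
Proof. by rewrite /gr_mul raddf0. Qed.

Lemma gr_mulC : commutative gr_mul.
Proof.
have h0 x : gr_mul x 0 = 0.
  by apply: (addIr (gr_mul x 0)); rewrite -gr_mulDr !addr0 add0r.
elim/malg_ind=> [y|c a|x y IHx IHy z]; first by rewrite h0 gr_mul0r.
  elim/malg_ind=> [|d b|x y IHx IHy]; first by rewrite h0 gr_mul0r.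
    by rewrite !gr_mulUU mulrC mulgC.
  by rewrite gr_mulDl gr_mulDr IHx IHy.
by rewrite gr_mulDl gr_mulDr IHx IHy.
Qed.

Lemma gr_mulA : associative gr_mul.
Proof.
have h0 x : gr_mul x 0 = 0 by rewrite gr_mulC gr_mul0r.
elim/malg_ind=> [y z|c a|x x' IH IH' y z]; first by rewrite !gr_mul0r.
  elim/malg_ind=> [z|d b|y y' IH IH' z]; first by rewrite gr_mul0r h0 gr_mul0r.
    elim/malg_ind=> [|e k|z z' IH IH']; first by rewrite !h0.
      by rewrite !gr_mulUU mulrA mulgA.
    by rewrite !gr_mulDr IH IH'.
  by rewrite gr_mulDl !gr_mulDr gr_mulDl IH IH'.
by rewrite !gr_mulDl IH IH'.
Qed.

Lemma gr_mul1 : left_id (gr_elt 1%g) gr_mul.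
Proof.
elim/malg_ind=> [|c a|x y IHx IHy]; first by rewrite gr_mulC gr_mul0r.
  by rewrite gr_mulUU mul1r mul1g.
by rewrite gr_mulDr IHx IHy.
Qed.

Lemma gr_1neq0 : gr_elt 1%g != 0.
Proof. by rewrite /gr_elt monalgU_eq0 oner_eq0. Qed.

HB.instance Definition _ := GRing.Zmodule_isComNzRing.Build (grpring A)
  gr_mulA gr_mulC gr_mul1 gr_mulDl gr_1neq0.

Lemma gr_elt1 : gr_elt 1%g = 1. Proof. by []. Qed.

Lemma gr_eltM (a b : A) : gr_elt (a * b)%g = gr_elt a * gr_elt b.
Proof. by rewrite /gr_elt -[RHS]/(gr_mul _ _) gr_mulUU. Qed.

End GroupRing.

Section GroupRingMap.
Context (A B : comGroupType) (f : UMagmaMorphism.type A B).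

Definition gr_map (x : grpring A) : grpring B :=
  flin (fun a => gr_elt (f a)) x.

Lemma gr_map_elt (a : A) : gr_map (gr_elt a) = gr_elt (f a).
Proof. by rewrite /gr_map flinU scale1r. Qed.

Fact gr_map_is_zmod_morphism : zmod_morphism gr_map.
Proof. by move=> x y; rewrite /gr_map raddfB. Qed.

HB.instance Definition _ := GRing.isZmodMorphism.Build (grpring A) (grpring B)
  gr_map gr_map_is_zmod_morphism.

Fact gr_map_is_monoid_morphism : GRing.monoid_morphism gr_map.
Proof.
split=> [|x y]; first by rewrite -gr_elt1 gr_map_elt gmulf1.
have D : {morph gr_map : u v / u + v} by exact: raddfD.
have Z : gr_map 0 = 0 by exact: raddf0.
have U c a : gr_map << c *g a >> = << c *g f a >>.
  by rewrite /gr_map flinU malgZU mulr1.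
elim/malg_ind: x => [|c a|x x' IH IH']; first by rewrite mul0r !Z mul0r.
  elim/malg_ind: y => [|d b|y y' IH IH']; first by rewrite mulr0 !Z mulr0.
    by rewrite -[_ * _]/(gr_mul _ _) -[RHS]/(gr_mul _ _) gr_mulUU !U gr_mulUU gmulfM.
  by rewrite mulrDr !D mulrDr IH IH'.
by rewrite mulrDl !D mulrDl IH IH'.
Qed.

HB.instance Definition _ := GRing.isMonoidMorphism.Build (grpring A) (grpring B)
  gr_map gr_map_is_monoid_morphism.

End GroupRingMap.

Definition submod_gen (R : nzRingType) (V : lmodType R) (G : set V) : set V :=
  smallest [set N : set V | submod_closed [pred x | x \in N]] G.

Section QuotientModule.
Context (R : nzRingType) (V : lmodType R) (G : set V).

Definition in_submod_gen : {pred V} := [pred x | x \in submod_gen G].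

Lemma submod_gen_closed : submod_closed in_submod_gen.
Proof.
split=> [|a x y].
  by apply: mem_set => N [[N0 _] _]; apply: set_mem N0.
move=> /set_mem hx /set_mem hy; apply: mem_set => N NG.
case: (NG) => [[_ NZ] _]; apply: set_mem; apply: NZ; apply: mem_set.
  exact: hx NG.
exact: hy NG.
Qed.

HB.instance Definition _ := GRing.isSubmodClosed.Build R V in_submod_gen
  submod_gen_closed.

Lemma submod_genW x : G x -> x \in in_submod_gen.
Proof. by move=> Gx; apply: mem_set => N [_]; exact. Qed.

Definition quotmod : Type := Quotient.quot in_submod_gen.
HB.instance Definition _ := GRing.Zmodule.on quotmod.

Definition quotmod_pi (x : V) : quotmod := \pi_(Quotient.quot in_submod_gen) x.

Lemma quotmod_pi_eq (x y : V) :
  quotmod_pi x = quotmod_pi y <-> x - y \in in_submod_gen.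
Proof.
rewrite /quotmod_pi; split=> [/eqP|h]; last apply/eqP;
  by rewrite -Quotient.idealrBE.
Qed.

Lemma quotmod_ind (P : quotmod -> Prop) :
  (forall x, P (quotmod_pi x)) -> forall q, P q.
Proof. by move=> h q; rewrite -[q]reprK; exact: h. Qed.

Definition quotmod_scale (a : R) (q : quotmod) : quotmod :=
  quotmod_pi (a *: repr (q : Quotient.quot in_submod_gen)).

Fact quotmod_pi_is_zmod_morphism : zmod_morphism quotmod_pi.
Proof. by move=> x y; rewrite /quotmod_pi raddfB. Qed.

HB.instance Definition _ := GRing.isZmodMorphism.Build V quotmod quotmod_pi
  quotmod_pi_is_zmod_morphism.

Lemma quotmod_scaleE a x : quotmod_scale a (quotmod_pi x) = quotmod_pi (a *: x).
Proof.
apply/quotmod_pi_eq; rewrite -scalerBr rpredZ //.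
by apply/quotmod_pi_eq; rewrite /quotmod_pi reprK.
Qed.

Fact quotmod_scaleA a b q :
  quotmod_scale a (quotmod_scale b q) = quotmod_scale (a * b) q.
Proof. by elim/quotmod_ind: q => x; rewrite !quotmod_scaleE scalerA. Qed.

Fact quotmod_scale1 : left_id 1 quotmod_scale.
Proof. by elim/quotmod_ind=> x; rewrite quotmod_scaleE scale1r. Qed.

Fact quotmod_scaleDr : right_distributive quotmod_scale +%R.
Proof.
move=> a; elim/quotmod_ind=> x; elim/quotmod_ind=> y.
by rewrite -raddfD !quotmod_scaleE scalerDr raddfD.
Qed.

Fact quotmod_scaleDl q : {morph quotmod_scale^~ q : a b / a + b}.
Proof.
by elim/quotmod_ind: q => x a b; rewrite !quotmod_scaleE scalerDl raddfD.
Qed.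

HB.instance Definition _ := GRing.Zmodule_isLmodule.Build R quotmod
  quotmod_scaleA quotmod_scale1 quotmod_scaleDr quotmod_scaleDl.

Fact quotmod_pi_is_scalable : scalable quotmod_pi.
Proof. by move=> a x; rewrite -quotmod_scaleE. Qed.

HB.instance Definition _ := GRing.isScalable.Build R V quotmod *:%R quotmod_pi
  quotmod_pi_is_scalable.

End QuotientModule.

Section RestrictScalars.
Context (S R : nzRingType) (f : {rmorphism S -> R}) (M : lmodType R).

Definition restr : Type := let _ := f in M.
HB.instance Definition _ := GRing.Zmodule.on restr.

Definition restr_scale (s : S) (m : restr) : restr := f s *: (m : M).

Fact restr_scaleA s t m :
  restr_scale s (restr_scale t m) = restr_scale (s * t) m.
Proof. by rewrite /restr_scale scalerA rmorphM. Qed.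
Fact restr_scale1 : left_id 1 restr_scale.
Proof. by move=> m; rewrite /restr_scale rmorph1 scale1r. Qed.
Fact restr_scaleDr : right_distributive restr_scale +%R.
Proof. by move=> s m n; rewrite /restr_scale scalerDr. Qed.
Fact restr_scaleDl m : {morph restr_scale^~ m : s t / s + t}.
Proof. by move=> s t; rewrite /restr_scale rmorphD scalerDl. Qed.

HB.instance Definition _ := GRing.Zmodule_isLmodule.Build S restr
  restr_scaleA restr_scale1 restr_scaleDr restr_scaleDl.

End RestrictScalars.

(* The tensor product R (x)_S N, where R is a right S-module through f: the
   free abelian group on R * N modulo S-balanced biadditivity. *)
Section ExtendScalars.
Context (S R : nzRingType) (f : {rmorphism S -> R}) (N : lmodType S).

Local Notation free := {malg int[(R * N)%type]}.

Inductive tens_rel : set free :=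
| TensDl r r' n : tens_rel (<< (r + r', n) >> - << (r, n) >> - << (r', n) >>)
| TensDr r n n' : tens_rel (<< (r, n + n') >> - << (r, n) >> - << (r, n') >>)
| TensA r s n : tens_rel (<< (r * f s, n) >> - << (r, s *: n) >>).

Definition tens : Type := quotmod tens_rel.
HB.instance Definition _ := GRing.Zmodule.on tens.

Definition tens_pi (x : free) : tens := quotmod_pi tens_rel x.

Fact tens_pi_is_zmod_morphism : zmod_morphism tens_pi.
Proof. exact: raddfB. Qed.
HB.instance Definition _ := GRing.isZmodMorphism.Build free tens tens_pi
  tens_pi_is_zmod_morphism.

Definition tensor (r : R) (n : N) : tens := tens_pi << (r, n) >>.

Lemma tens_pi0 x : x \in in_submod_gen tens_rel -> tens_pi x = 0.
Proof. by move=> h; rewrite -(raddf0 tens_pi); apply/quotmod_pi_eq; rewrite subr0. Qed.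

Lemma tensorDl r r' n : tensor (r + r') n = tensor r n + tensor r' n.
Proof.
apply/eqP; rewrite -subr_eq0 opprD addrA -!raddfB; apply/eqP/tens_pi0.
exact/submod_genW/TensDl.
Qed.

Lemma tensorDr r n n' : tensor r (n + n') = tensor r n + tensor r n'.
Proof.
apply/eqP; rewrite -subr_eq0 opprD addrA -!raddfB; apply/eqP/tens_pi0.
exact/submod_genW/TensDr.
Qed.

Lemma tensorA r s n : tensor (r * f s) n = tensor r (s *: n).
Proof.
apply/eqP; rewrite -subr_eq0 -!raddfB; apply/eqP/tens_pi0.
exact/submod_genW/TensA.
Qed.

Definition tens_lmul (a : R) : free -> free :=
  flin (fun p => << (a * p.1, p.2) >>).

Definition tens_scale (a : R) (t : tens) : tens :=
  tens_pi (tens_lmul a (repr (t : Quotient.quot (in_submod_gen tens_rel)))).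

Lemma tens_lmulU a c r n :
  tens_lmul a << c *g (r, n) >> = << c *g (a * r, n) >>.
Proof. by rewrite /tens_lmul flinU malgZU mulr1. Qed.

Lemma tens_lmul_gen a x :
  x \in in_submod_gen tens_rel -> tens_lmul a x \in in_submod_gen tens_rel.
Proof.
move=> /set_mem hx; apply: set_mem; apply: mem_set.
pose M : set free := [set y | tens_lmul a y \in in_submod_gen tens_rel].
apply: (hx M); split.
  split=> [|k y z /set_mem My /set_mem Mz]; apply: mem_set; rewrite /M /=.
    by rewrite /tens_lmul raddf0 rpred0.
  by rewrite /tens_lmul linearP rpredD // rpredZ.
move=> _ [r r' n|r n n'|r s n]; rewrite /M /= /tens_lmul !raddfB /=;
  rewrite -!/(tens_lmul a _) !tens_lmulU.
- by rewrite mulrDr; apply/submod_genW/TensDl.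
- exact/submod_genW/TensDr.
- by rewrite mulrA; apply/submod_genW/TensA.
Qed.

Lemma tens_scaleE a x : tens_scale a (tens_pi x) = tens_pi (tens_lmul a x).
Proof.
apply/eqP; rewrite -subr_eq0 -raddfB; apply/eqP/tens_pi0.
rewrite /tens_lmul -raddfB; apply: tens_lmul_gen.
by apply/quotmod_pi_eq; rewrite /quotmod_pi reprK.
Qed.

Lemma tens_scale_tensor a r n : tens_scale a (tensor r n) = tensor (a * r) n.
Proof. by rewrite tens_scaleE tens_lmulU. Qed.

Lemma tens_pi_ind (P : tens -> Prop) : (forall x, P (tens_pi x)) -> forall t, P t.
Proof. exact: quotmod_ind. Qed.

Fact tens_scaleDr : right_distributive tens_scale +%R.
Proof.
move=> a; elim/tens_pi_ind=> x; elim/tens_pi_ind=> y.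
by rewrite -raddfD !tens_scaleE /tens_lmul !raddfD.
Qed.

Lemma tensorB0 r : tensor r 0 = 0.
Proof. by apply: (addIr (tensor r 0)); rewrite -tensorDr !add0r. Qed.

Lemma tens_scale0 a : tens_scale a 0 = 0.
Proof. by apply: (addIr (tens_scale a 0)); rewrite -tens_scaleDr !add0r. Qed.

Lemma tens_ind (P : tens -> Prop) :
  P 0 -> (forall r n, P (tensor r n)) ->
  (forall t u, P t -> P u -> P (t + u)) -> forall t, P t.
Proof.
move=> P0 PU PD; elim/tens_pi_ind; elim/malg_ind=> [|c [r n]|g h Pg Ph].
- by rewrite raddf0.
- have PN r' n' : P (- tensor r' n').
    suff -> : - tensor r' n' = tensor r' (- n') by exact: PU.
    by apply/eqP; rewrite eq_sym -addr_eq0 -tensorDr addNr tensorB0.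
  have -> : tens_pi << c *g (r, n) >> = tensor r n *~ c.
    by rewrite -[c in LHS]intz (raddfMz (mkmalgU (r, n))) raddfMz.
  case: c => k; rewrite ?NegzE ?mulrNz -pmulrn.
    by elim: k => [|k IH]; rewrite ?mulr0n // mulrS; apply: PD.
  by elim: k => [|k IH]; rewrite ?mulr1n // mulrS opprD; apply: PD.
- by rewrite raddfD; apply: PD.
Qed.

Fact tens_scaleA a b t : tens_scale a (tens_scale b t) = tens_scale (a * b) t.
Proof.
elim/tens_ind: t => [|r n|t u IHt IHu]; first by rewrite !tens_scale0.
  by rewrite !tens_scale_tensor mulrA.
by rewrite !tens_scaleDr IHt IHu.
Qed.

Fact tens_scale1 : left_id 1 tens_scale.
Proof.
elim/tens_ind=> [|r n|t u IHt IHu]; first by rewrite tens_scale0.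
  by rewrite tens_scale_tensor mul1r.
by rewrite tens_scaleDr IHt IHu.
Qed.

Fact tens_scaleDl t : {morph tens_scale^~ t : a b / a + b}.
Proof.
move=> a b; elim/tens_ind: t => [|r n|t u IHt IHu].
- by rewrite !tens_scale0 addr0.
- by rewrite !tens_scale_tensor mulrDl tensorDl.
- by rewrite !tens_scaleDr IHt IHu addrACA.
Qed.

HB.instance Definition _ := GRing.Zmodule_isLmodule.Build R tens
  tens_scaleA tens_scale1 tens_scaleDr tens_scaleDl.

Lemma scale_tensor a r n : a *: tensor r n = tensor (a * r) n.
Proof. exact: tens_scale_tensor. Qed.

End ExtendScalars.


Section MultiplicativeGroup.
Context (F : fieldType).

Definition mulgrp : Type := {x : F | x != 0}.
HB.instance Definition _ := SubType.on mulgrp.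
HB.instance Definition _ := Choice.on mulgrp.

Implicit Types x y : mulgrp.

Definition mulgrp_one : mulgrp := Sub 1 (oner_neq0 F).
Definition mulgrp_mul x y : mulgrp :=
  Sub (val x * val y) (mulf_neq0 (valP x) (valP y)).
Definition mulgrp_inv x : mulgrp := Sub (val x)^-1 (invr_neq0 (valP x)).

Fact mulgrp_mulA : associative mulgrp_mul.
Proof. by move=> x y z; apply: val_inj; rewrite /= mulrA. Qed.
Fact mulgrp_mulC : commutative mulgrp_mul.
Proof. by move=> x y; apply: val_inj; rewrite /= mulrC. Qed.
Fact mulgrp_mul1 : left_id mulgrp_one mulgrp_mul.
Proof. by move=> x; apply: val_inj; rewrite /= mul1r. Qed.
Fact mulgrp_1mul : right_id mulgrp_one mulgrp_mul.
Proof. by move=> x; rewrite mulgrp_mulC mulgrp_mul1. Qed.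
Fact mulgrp_mulV : left_inverse mulgrp_one mulgrp_inv mulgrp_mul.
Proof. by move=> x; apply: val_inj; rewrite /= mulVf ?(valP x). Qed.
Fact mulgrp_Vmul : right_inverse mulgrp_one mulgrp_inv mulgrp_mul.
Proof. by move=> x; rewrite mulgrp_mulC mulgrp_mulV. Qed.

HB.instance Definition _ := isGroup.Build mulgrp
  mulgrp_mulA mulgrp_mul1 mulgrp_1mul mulgrp_mulV mulgrp_Vmul.
HB.instance Definition _ := Group_isComGroup.Build mulgrp mulgrp_mulC.

Lemma val_mulgM x y : val (x * y)%g = val x * val y. Proof. by []. Qed.
Lemma val_mulg1 : val (1%g : mulgrp) = 1. Proof. by []. Qed.
Lemma val_mulgV x : val x^-1%g = (val x)^-1. Proof. by []. Qed.

(* G_F and R_F. *)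
Definition sqgroup : comGroupType := sqclass mulgrp.

Definition sqring : comNzRingType := grpring sqgroup.

(* The square class <x>, for x != 0; the value 0 at x = 0 is junk. *)
Definition sqcl (x : F) : sqring :=
  if insub x is Some u then gr_elt (sqc (u : mulgrp)) else 0.

(* The element <<x>>. *)
Definition dsqcl (x : F) : sqring := sqcl x - 1.

End MultiplicativeGroup.

Section RefinedPreBloch.
Context (F : fieldType).
Local Notation R := (sqring F).

Definition card_is (n : nat) : Prop := ([set: F] #= `I_n)%card.
Definition card_ge (n : nat) : Prop := (`I_n #<= [set: F])%card.

(* Generators: Some u stands for [u], and None for the distinguished generator
   of RP(F_2). RP_noC kills None when F is not F_2; over F_2, where G_F is
   trivial, RP_F2 makes the module a group of order 3. *)
Local Notation free := {malg R[option (mulgrp F)]}.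

(* [x] for x != 0, with the junk value 0 at x = 0. *)
Definition fsymb (x : F) : free :=
  if insub x is Some u then << Some (u : mulgrp F) >> else 0.

Definition five_term (x y : F) : free :=
  fsymb x - fsymb y + sqcl x *: fsymb (y / x)
  - sqcl (x^-1 - 1) *: fsymb ((1 - x^-1) / (1 - y^-1))
  + sqcl (1 - x) *: fsymb ((1 - x) / (1 - y)).

Inductive RP_rel : set free :=
| RP_one : RP_rel (fsymb 1)
| RP_five of card_ge 4 :
    forall x y, x != 0 -> x != 1 -> y != 0 -> y != 1 -> RP_rel (five_term x y)
| RP_F3 of card_is 3 : RP_rel ((fsymb (-1) + sqcl (-1) *: fsymb (-1)) *+ 2)
| RP_F2 of card_is 2 : RP_rel (<< None >> *+ 3)
| RP_noC of ~ card_is 2 : RP_rel << None >>.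

Definition RP : lmodType R := quotmod RP_rel.

Definition symb (x : F) : RP := quotmod_pi RP_rel (fsymb x).

Definition psi1 (x : F) : RP := symb x + sqcl (-1) *: symb x^-1.

(* The formulas for psi1 and psi2 also apply to F_2 and F_3: they give 0 at 1,
   and both give [-1] + <-1>[-1] at -1 in F_3. *)
Definition psi2 (x : F) : RP :=
  if x == 1 then 0 else sqcl (1 - x) *: (sqcl x *: symb x + symb x^-1).

Definition bloch_K1 : set RP := submod_gen [set psi1 x | x in [set x | x != 0]].
Definition bloch_K2 : set RP := submod_gen [set psi2 x | x in [set x | x != 0]].

Definition RPhat_rel : set RP := [set a + b | a in bloch_K1 & b in bloch_K2].

Definition RPhat : lmodType R := quotmod RPhat_rel.

Definition RPhat_pi : {linear RP -> RPhat} := quotmod_pi RPhat_rel.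

Definition bloch_const_at (x : F) : RP :=
  symb x + sqcl (-1) *: symb (1 - x) + dsqcl (1 - x) *: psi1 x.

(* When F has at least 4 elements, bloch_const_at does not depend on
   x != 0, 1; the definition takes its value at a chosen such x. *)
Definition bloch_const : RP :=
  if pselect (card_is 2) then quotmod_pi RP_rel << None >>
  else if pselect (card_is 3) then psi1 (-1)
  else bloch_const_at (xget 0 [set x : F | x != 0 /\ x != 1]).

End RefinedPreBloch.

HB.mixin Record POrderedZmodule_isOrderedAb G of Num.POrderedZmodule G := {
  oab_le_total : total (<=%R : rel G);
  oab_leD2l : forall z x y : G, x <= y -> z + x <= z + y
}.

#[short(type="orderedAbType")]
HB.structure Definition OrderedAb :=
  {G of POrderedZmodule_isOrderedAb G & Num.POrderedZmodule G}.

Record valuation (F : fieldType) (G : orderedAbType) := Valuation {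
  valn :> mulgrp F -> G;
  valnM : forall x y, valn (x * y)%g = valn x + valn y;
  valnD : forall x y z, val x + val y = val z ->
    Order.min (valn x) (valn y) <= valn z;
  valn_surj : forall g, exists x, valn x = g
}.

Section ValuationTheory.
Context (F : fieldType) (G : orderedAbType) (v : valuation F G).
Implicit Types (x y : F) (u w : mulgrp F).

Lemma valn1 : v 1%g = 0.
Proof. by apply: (addIr (v 1%g)); rewrite -valnM mulg1 add0r. Qed.

Lemma valnV u : v u^-1%g = - v u.
Proof. by apply/eqP; rewrite -addr_eq0 -valnM mulVg valn1. Qed.

Lemma oab_leD (a b c d : G) : a <= b -> c <= d -> a + c <= b + d.
Proof.
move=> ab cd; apply: (@le_trans _ _ (a + d)); first exact: oab_leD2l.
by rewrite ![_ + d]addrC oab_leD2l.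
Qed.

Lemma oab_ltD2l (a b c : G) : (c + a < c + b) = (a < b).
Proof.
have mono (x y z : G) : x < y -> z + x < z + y.
  by rewrite !lt_neqAle => /andP[ne le]; rewrite oab_leD2l // (inj_eq (addrI z)) ne.
by apply/idP/idP => [/(mono _ _ (- c))|/mono//]; rewrite !addKr.
Qed.

Lemma oab_ltNge (a b : G) : (a < b) = ~~ (b <= a).
Proof.
have [ba|] := boolP (b <= a); first by apply/negP => /lt_geF; rewrite ba.
have := oab_le_total a b; rewrite lt_neqAle; case/orP=> [->|->//].
by rewrite andbT => nba; apply: contraNneq nba => ->.
Qed.

(* 0 <= v x and 0 < v x, extended to F by v 0 = +oo. *)
Definition vring : {pred F} :=
  fun x => if insub x is Some u then 0 <= v u else true.
Definition vmax : {pred F} :=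
  fun x => if insub x is Some u then 0 < v u else true.

Lemma vring0 : 0 \in vring.
Proof. by rewrite unfold_in insubF // eqxx. Qed.

Lemma vmax0 : 0 \in vmax.
Proof. by rewrite unfold_in insubF // eqxx. Qed.

Lemma vringE u : (val u \in vring) = (0 <= v u).
Proof. by rewrite unfold_in valK. Qed.

Lemma vmaxE u : (val u \in vmax) = (0 < v u).
Proof. by rewrite unfold_in valK. Qed.

Lemma mulgrpP x : x = 0 \/ exists u : mulgrp F, x = val u.
Proof.
have [->|nx] := eqVneq x 0; [by left|right].
by exists (Sub x nx : mulgrp F); rewrite SubK.
Qed.

Lemma vring_mul x y : x \in vring -> y \in vring -> x * y \in vring.
Proof.
case: (mulgrpP x) => [->|[u ->]]; first by rewrite mul0r.
case: (mulgrpP y) => [->|[w ->]]; first by rewrite mulr0.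
rewrite -val_mulgM !vringE valnM => hu hw.
by rewrite -(addr0 0) oab_leD.
Qed.

Lemma vmax_mul x y : x \in vring -> y \in vmax -> x * y \in vmax.
Proof.
case: (mulgrpP x) => [->|[u ->]]; first by rewrite mul0r vmax0.
case: (mulgrpP y) => [->|[w ->]]; first by rewrite mulr0 vmax0.
rewrite -val_mulgM vringE !vmaxE valnM => hu hw.
by apply: (le_lt_trans hu); rewrite -[ltLHS]addr0 oab_ltD2l.
Qed.

Lemma oab_double0 (a : G) : a + a = 0 -> a = 0.
Proof.
move=> h; apply/eqP; rewrite eq_le.
have [le|le] := orP (oab_le_total a 0); rewrite le ?andbT /=.
  by have := oab_leD2l a _ _ le; rewrite addr0 h.
by have := oab_leD2l a _ _ le; rewrite addr0 h.
Qed.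

Definition mulgN1 : mulgrp F := Sub (-1) (lreg_neq0 (@lregN _ _ (@lreg1 F))).

Lemma valnN1 : v mulgN1 = 0.
Proof.
apply: oab_double0; rewrite -valnM -valn1; congr (v _).
by apply: val_inj; rewrite val_mulgM /= mulrNN mulr1.
Qed.

Lemma vringN1 : -1 \in vring.
Proof. by rewrite -[-1]/(val mulgN1) vringE valnN1. Qed.

Lemma vring1 : 1 \in vring.
Proof. by rewrite -(val_mulg1 F) vringE valn1. Qed.

Lemma vring_add x y : x \in vring -> y \in vring -> x + y \in vring.
Proof.
case: (mulgrpP x) => [->|[u ->]]; first by rewrite add0r.
case: (mulgrpP y) => [->|[w ->]]; first by rewrite addr0.
case: (mulgrpP (val u + val w)) => [->|[z e]]; first by rewrite vring0.
rewrite e !vringE => hu hw; apply: le_trans (valnD v e).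
by rewrite /Order.min; case: ifP.
Qed.

Lemma vmax_add x y : x \in vmax -> y \in vmax -> x + y \in vmax.
Proof.
case: (mulgrpP x) => [->|[u ->]]; first by rewrite add0r.
case: (mulgrpP y) => [->|[w ->]]; first by rewrite addr0.
case: (mulgrpP (val u + val w)) => [->|[z e]]; first by rewrite vmax0.
rewrite e !vmaxE => hu hw; apply: lt_le_trans (valnD v e).
by rewrite /Order.min; case: ifP.
Qed.

Fact vring_subring_closed : subring_closed vring.
Proof.
split=> [|x y hx hy|x y]; [exact: vring1| |exact: vring_mul].
by rewrite -mulN1r; apply: vring_add => //; apply: vring_mul vringN1 _.
Qed.

HB.instance Definition _ := GRing.isSubringClosed.Build F vring
  vring_subring_closed.

Definition valring : Type := {x : F | x \in vring}.
HB.instance Definition _ := SubChoice.on valring.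
HB.instance Definition _ := [SubChoice_isSubComNzRing of valring by <:].

Definition valideal : {pred valring} := fun x : valring => val x \in vmax.

Lemma vmax_unit u : v u = 0 -> val u \in vmax = false.
Proof. by rewrite vmaxE => ->; rewrite ltxx. Qed.

Fact valideal_closed : idealr_closed valideal.
Proof.
split=> [||a z t hz ht].
- exact: vmax0.
- by rewrite unfold_in /= -(val_mulg1 F) vmax_unit ?valn1.
- by apply: vmax_add => //; apply: vmax_mul => //; apply: (valP a).
Qed.

HB.instance Definition _ := isIdealr.Build valring valideal valideal_closed.

Definition resfield : Type := {ideal_quot valideal}.
HB.instance Definition _ := GRing.ComNzRing.on resfield.

Definition residue_pi (x : valring) : resfield := \pi_{ideal_quot valideal} x.

Lemma residue_pi_eq0 (x : valring) : (residue_pi x == 0) = (val x \in vmax).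
Proof.
by rewrite -[0](raddf0 (\pi_{ideal_quot valideal})) -Quotient.idealrBE subr0.
Qed.

Fact residue_piM (x y : valring) : residue_pi (x * y) = residue_pi x * residue_pi y.
Proof. by rewrite /residue_pi rmorphM. Qed.

Fact residue_pi1 : residue_pi 1 = 1.
Proof. by rewrite /residue_pi rmorph1. Qed.

Lemma residue_pi_ind (P : resfield -> Prop) :
  (forall x : valring, P (residue_pi x)) -> forall a, P a.
Proof. by move=> h a; rewrite -[a]reprK; exact: h. Qed.

Lemma residue_pi_unit (x : valring) : residue_pi x != 0 -> exists2 u, val x = val u & v u = 0.
Proof.
rewrite residue_pi_eq0; case: (mulgrpP (val x)) => [->|[u e]].
  by rewrite vmax0.
rewrite e vmaxE oab_ltNge negbK => le; exists u => //.
by apply/eqP; rewrite eq_le le -vringE -e; apply: (valP x).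
Qed.

Definition resfield_inv (a : resfield) : resfield :=
  if a == 0 then 0 else
    residue_pi (insubd 0 (val (repr (a : {ideal_quot valideal})))^-1).

Fact resfield_mulVf a : a != 0 -> resfield_inv a * a = 1.
Proof.
move=> na; rewrite /resfield_inv (negPf na).
rewrite -{2}[a](reprK (a : {ideal_quot valideal})) -residue_piM.
have : residue_pi (repr (a : {ideal_quot valideal})) != 0.
  by rewrite /residue_pi reprK.
case/residue_pi_unit=> u e vu; rewrite -residue_pi1; congr residue_pi; apply: val_inj => /=.
rewrite val_insubd e -val_mulgV vringE valnV vu oppr0 lexx.
by rewrite -val_mulgM mulVg.
Qed.

Fact resfield_inv0 : resfield_inv 0 = 0.
Proof. by rewrite /resfield_inv eqxx. Qed.

HB.instance Definition _ := GRing.ComNzRing_isField.Build resfield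
  resfield_mulVf resfield_inv0.

(* The image of x in the residue field, for x in the valuation ring; the value
   0 at the other x is junk. *)
Definition residue (x : F) : resfield :=
  if insub x is Some y then residue_pi (y : valring) else 0.

Lemma residueE x (hx : x \in vring) : residue x = residue_pi (Sub x hx).
Proof. by rewrite /residue insubT. Qed.

Lemma residue1 : residue 1 = 1.
Proof. by rewrite (residueE vring1) -residue_pi1; congr residue_pi; apply: val_inj. Qed.

Lemma residueM x y :
  x \in vring -> y \in vring -> residue (x * y) = residue x * residue y.
Proof.
move=> hx hy; rewrite (residueE hx) (residueE hy) (residueE (vring_mul hx hy)).
by rewrite -residue_piM; congr residue_pi; apply: val_inj.
Qed.

Definition vunit : {pred mulgrp F} := fun u => v u == 0.

Fact vunit_group_closed : group_closed vunit.
Proof.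
split=> [|u w]; first by rewrite unfold_in valn1.
by rewrite !unfold_in valnM valnV => /eqP-> /eqP->; rewrite subrr.
Qed.

Definition valunits : Type := {u : mulgrp F | u \in vunit}.
HB.instance Definition _ := SubChoice.on valunits.
HB.instance Definition _ :=
  SubChoice_isSubGroup.Build (mulgrp F) vunit valunits vunit_group_closed.

Fact valunits_mulC : commutative ( *%g : valunits -> valunits -> valunits).
Proof. by move=> a b; apply: val_inj; rewrite !valM mulgC. Qed.
HB.instance Definition _ := Group_isComGroup.Build valunits valunits_mulC.

Definition valunits_incl (a : valunits) : mulgrp F := val a.

Fact valunits_incl_is_morphism : monoid.monoid_morphism valunits_incl.
Proof. by split=> [|a b]; rewrite /valunits_incl ?val1 ?valM. Qed.
HB.instance Definition _ := isUMagmaMorphism.Build valunits (mulgrp F)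
  valunits_incl valunits_incl_is_morphism.

Fact residue_unit (a : valunits) : residue (val (val a)) != 0.
Proof.
have va : v (val a) = 0 by apply/eqP; apply: (valP a).
have h : val (val a) \in vring by rewrite vringE va.
by rewrite /residue insubT residue_pi_eq0 /= vmax_unit.
Qed.

Definition valunits_red (a : valunits) : mulgrp resfield :=
  Sub (residue (val (val a))) (residue_unit a).

Fact valunits_red_is_morphism : monoid.monoid_morphism valunits_red.
Proof.
have vr (a : valunits) : val (val a) \in vring.
  by rewrite vringE; have /eqP-> := valP a.
split=> [|a b]; apply: val_inj.
  exact: residue1.
by rewrite val_mulgM /= residueM ?vr // valM.
Qed.
HB.instance Definition _ := isUMagmaMorphism.Build valunits (mulgrp resfield)
  valunits_red valunits_red_is_morphism.

Definition valunits_sqring : comNzRingType := grpring (sqclass valunits).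

Definition sqring_incl : {rmorphism valunits_sqring -> sqring F} :=
  gr_map (sqc_map valunits_incl).

Definition sqring_red : {rmorphism valunits_sqring -> sqring resfield} :=
  gr_map (sqc_map valunits_red).

(* The R_F-module M_F: R_F tensored with M over Z[U/U^2]. *)
Definition extF (M : lmodType (sqring resfield)) : lmodType (sqring F) :=
  tens sqring_incl (restr sqring_red M).

Definition ext_tensor (M : lmodType (sqring resfield)) (r : sqring F) (m : M) : extF M :=
  tensor sqring_incl r (m : restr sqring_red M).

End ValuationTheory.

(* Main.v *)
From HB Require Import structures.
Require Import Defs.
From mathcomp.multinomials Require Import monalg.
From mathcomp Require Import all_boot all_order all_algebra.
From mathcomp Require Import generic_quotient finmap.
From mathcomp Require Import boolp classical_sets cardinality ring.

Set Implicit Arguments.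
Unset Strict Implicit.
Unset Printing Implicit Defensive.

Import Order.TTheory GRing.Theory Num.Theory.

Local Open Scope classical_set_scope.
Local Open Scope ring_scope.

(** Write k for the residue field, P for the quotient RPhat(k) and C for the
    image in P of the constant C_k.  Let tau(x) in P be the class of the residue
    of x when v(x) = 0, the constant C when v(x) > 0 and -C when v(x) < 0.  The
    map S_v has to send [x] to 1 (x) tau(x), so everything rests on checking
    that x |-> 1 (x) tau(x) satisfies the five-term relation.

    Killing psi_1 and psi_2 gives P its strength.  In P one has
    [1/x] = -<-1>[x] = -<x>[x], so that <x>[x] = <-1>[x].  The sum
    [x] + <-1>[1 - x] does not depend on x: add to the five-term relation of
    (x, y) its image for (1 - x, 1 - y) multiplied by <-1>, and all terms except
    the two sums cancel because [z] + <-1>[1/z] = 0 ([bloch_sum_const]).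
    Its value is C.  Comparing the sums at x, 1/x and 1/(1 - x) yields
    3C = 0 ([bloch_sum3]) and (<x> + <1 - x> + 1)C = 0; the last relation at x
    and at 1/x gives <x>C = C ([bloch_sum_stable]).  If k has two elements there
    is no such x, but 3C = 0 holds by definition and <1> is the only class.

    For the five-term relation put p = 1 - x and q = 1 - y.  Up to squares it
    reads
      [x] - [y] + <x>[y/x] - <p><x>[(p/q)(y/x)] + <p>[p/q] = 0,
    so that it only involves products of the four elements x, y, p, q.  The pair
    (x, p) has one of four types: v(x) > 0 and p is a unit with residue 1; x and
    p are units; x is a unit with residue 1 and v(p) > 0; v(x) < 0 and p/x is a
    unit with residue -1.  The same holds for (y, q), and in each of the sixteen
    cases the relation reduces to the five-term relation of k, to a consequence
    of [x] + <-1>[1 - x] = C and of the two formulas for [1/x], to 3C = 0, or to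
    nothing
    ([specialization_five_term]).  The square class of a nonunit does not act
    through the residue field, so its contributions have to cancel among
    themselves.

    Surjectivity holds because units lift from k to F, hence R_k is a quotient
    of Z[U/U^2] and the elements 1 (x) [a] are in the image.  When k has two
    elements P is generated by C instead.  Then 1 (x) C or its opposite is the
    value at any nonunit; if there is none, then F has two elements as well and the
    distinguished generator of RP(F) is sent there. *)

(** * Quotients of modules by generated submodules *)

Section QuotientLinear.
Context (R : nzRingType) (V : lmodType R) (G : set V).

Lemma quotmod_pi0 x : x \in in_submod_gen G -> quotmod_pi G x = 0.
Proof.
move=> h; rewrite -(raddf0 (quotmod_pi G)).
by apply/quotmod_pi_eq; rewrite subr0.
Qed.

Lemma submod_gen0 : submod_gen G 0.
Proof. exact/set_mem/(rpred0 (in_submod_gen G)). Qed.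

Lemma submod_gen_sub x : G x -> submod_gen G x.
Proof. by move=> Gx; exact/set_mem/(submod_genW Gx). Qed.

Lemma quotmod_pi_gen0 x : G x -> quotmod_pi G x = 0.
Proof. by move=> Gx; apply/quotmod_pi0/submod_genW. Qed.

End QuotientLinear.

Section QuotientLift.
Context (R : nzRingType) (V W : lmodType R) (G : set V) (f : {linear V -> W}).

Lemma submod_gen_ker : (forall x, G x -> f x = 0) ->
  forall x, x \in in_submod_gen G -> f x = 0.
Proof.
move=> fG x /set_mem hx; apply: (hx [set y | f y = 0]); split; last first.
  by move=> y; exact: fG.
split=> [|a y z /set_mem /= fy /set_mem /= fz]; apply: mem_set => /=.
  by rewrite raddf0.
by rewrite linearP fy fz scaler0 addr0.
Qed.

Lemma quotmod_lift : (forall x, G x -> f x = 0) ->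
  exists g : {linear quotmod G -> W}, forall x, g (quotmod_pi G x) = f x.
Proof.
move=> fG.
pose g (q : quotmod G) : W := f (repr (q : Quotient.quot (in_submod_gen G))).
have gE x : g (quotmod_pi G x) = f x.
  apply/eqP; rewrite -subr_eq0 -raddfB; apply/eqP/submod_gen_ker => //.
  by apply/quotmod_pi_eq; rewrite /quotmod_pi reprK.
have glin : linear g.
  move=> a; elim/quotmod_ind=> x; elim/quotmod_ind=> y.
  by rewrite -linearP !gE linearP.
pose gL := GRing.isLinear.Build _ _ _ _ g glin.
pose gg : {linear quotmod G -> W} := HB.pack g gL.
by exists gg.
Qed.
End QuotientLift.

(** * Square classes in the group ring *)

Section SquareCharacter.
Context (K : fieldType) (R : comNzRingType) (s : K -> R).
Context (sM : forall x y, x != 0 -> y != 0 -> s (x * y) = s x * s y).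
Context (s_sqr : forall x, x != 0 -> s x * s x = 1).

Lemma square_character1 : s 1 = 1.
Proof. by have := s_sqr (oner_neq0 K); rewrite -sM ?oner_neq0 // mulr1. Qed.

Lemma square_characterV x : x != 0 -> s x^-1 = s x.
Proof.
move=> x0; rewrite -[LHS]mulr1 -(s_sqr x0) mulrA -sM ?invr_eq0 //.
by rewrite mulVf // square_character1 mul1r.
Qed.

(** The scalar <1/x - 1> of the five-term relation, up to squares. *)
Lemma square_character_inv_sub1 x : x != 0 -> x != 1 ->
  s (x^-1 - 1) = s (1 - x) * s x.
Proof.
move=> x0 x1; have p0 : 1 - x != 0 by rewrite subr_eq0 eq_sym.
have xV0 : x^-1 != 0 by rewrite invr_eq0.
rewrite -(square_characterV x0) -(sM p0 xV0); congr s.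
by rewrite mulrBl divff // mul1r.
Qed.

End SquareCharacter.

Section SquareClass.
Context (F : fieldType).
Implicit Types x y : F.
Local Notation R := (sqring F).

Lemma sqclE x (nx : x != 0) : sqcl x = gr_elt (sqc (Sub x nx : mulgrp F)).
Proof. by rewrite /sqcl insubT. Qed.

Lemma sqclM x y : x != 0 -> y != 0 -> sqcl (x * y) = sqcl x * sqcl y.
Proof.
move=> nx ny; rewrite !sqclE ?mulf_neq0 // => nxy.
by rewrite -gr_eltM -sqcM; congr (gr_elt (sqc _)); apply: val_inj.
Qed.

Lemma sqcl_sqr x : x != 0 -> sqcl x * sqcl x = 1.
Proof.
move=> nx; rewrite sqclE -gr_eltM -sqcM -[RHS](gr_elt1 (sqgroup F)).
by congr gr_elt; exact: sqc_sqr.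
Qed.

Lemma sqcl1 : sqcl 1 = 1 :> R.
Proof. exact: square_character1 sqclM sqcl_sqr. Qed.

Lemma N1_neq0 : -1 != 0 :> F.
Proof. by rewrite oppr_eq0 oner_eq0. Qed.

Lemma sqclN1_sqr : sqcl (-1) * sqcl (-1) = 1 :> R.
Proof. exact: (sqcl_sqr N1_neq0). Qed.
End SquareClass.

(** * Identities between integral combinations in an abelian group *)

(** The sixteen cases below end with identities between integral combinations
    of elements of a module.  The tactic [abelian] proves them by comparing the
    integer coefficients of both sides. *)
Section AbelianIdentities.

Inductive zexpr := ZVar of nat | ZZero | ZOpp of zexpr | ZAdd of zexpr & zexpr.

Fixpoint zcoef (t : zexpr) (i : nat) : int :=
  match t with
  | ZVar j => (i == j)%:R
  | ZZero => 0
  | ZOpp t => - zcoef t i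
  | ZAdd t u => zcoef t i + zcoef u i
  end.

Context (M : zmodType) (env : seq M).

Fixpoint zeval (t : zexpr) : M :=
  match t with
  | ZVar j => env`_j
  | ZZero => 0
  | ZOpp t => - zeval t
  | ZAdd t u => zeval t + zeval u
  end.

Lemma zevalE t : zeval t = \sum_(i < size env) env`_i *~ zcoef t i.
Proof.
elim: t => [j||t IH|t IHt u IHu] /=.
- have [lt|ge] := ltnP j (size env).
    rewrite (bigD1 (Ordinal lt)) //= eqxx mulr1z big1 ?addr0 // => i.
    by rewrite -val_eqE /= => /negPf->.
  rewrite nth_default // big1 // => i _.
  by rewrite ltn_eqF ?mulr0z // (leq_trans (ltn_ord i)).
- by rewrite big1.
- by rewrite IH -sumrN; apply: eq_bigr => i _; rewrite mulrNz.
- by rewrite IHt IHu -big_split /=; apply: eq_bigr => i _; rewrite mulrzDr.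
Qed.

Lemma zeval_eq t u :
  all (fun i => zcoef t i == zcoef u i) (iota 0 (size env)) ->
  zeval t = zeval u.
Proof.
move=> /allP tu; rewrite !zevalE; apply: eq_bigr => i _; congr (_ *~ _).
by apply/eqP/tu; rewrite mem_iota /=.
Qed.

End AbelianIdentities.

(* Atoms are compared up to conversion: the same element often occurs with
   syntactically different structure instances. *)
Ltac zindex x env :=
  lazymatch env with
  | ?y :: ?env' =>
      match goal with
      | _ => let _ := constr:(erefl x : x = y) in constr:(0%N)
      | _ => let n := zindex x env' in constr:(S n)
      end
  end.

Ltac zatoms env t :=
  lazymatch t with
  | (?a + ?b)%R => let env := zatoms env a in zatoms env b
  | (- ?a)%R => zatoms env a
  | 0%R => env
  | _ => match env with
         | _ => let _ := zindex t env in env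
         | _ => constr:(t :: env)
         end
  end.

Ltac zreify env t :=
  lazymatch t with
  | (?a + ?b)%R =>
      let a := zreify env a in let b := zreify env b in constr:(ZAdd a b)
  | (- ?a)%R => let a := zreify env a in constr:(ZOpp a)
  | 0%R => constr:(ZZero)
  | _ => let n := zindex t env in constr:(ZVar n)
  end.

Ltac abelian :=
  lazymatch goal with
  | |- @eq ?T ?l ?r =>
      let env := zatoms (@nil T) l in let env := zatoms env r in
      let l' := zreify env l in let r' := zreify env r in
      apply: (@zeval_eq _ env l' r'); vm_compute; reflexivity
  end.

(** * The constant of a symbol that satisfies the five-term relation *)

(** With this the five-term relation involves only products of x, y, 1 - x
    and 1 - y. *)
Lemma cross_ratio_sub1 (K : fieldType) (x y : K) : x != 0 -> y != 0 -> y != 1 ->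
  (1 - x^-1) / (1 - y^-1) = ((1 - x) / (1 - y)) * (y / x).
Proof.
move=> x0 y0 y1; have q0 : 1 - y != 0 by rewrite subr_eq0 eq_sym.
by field; rewrite x0 y0 q0 -opprB oppr_eq0 q0.
Qed.

(** Here s stands for x |-> <x> and h for x |-> [x] in RPhat.  Only the
    relations listed are used, and keeping the ring and the module abstract
    prevents unification from unfolding the free modules behind them. *)
Section BlochConstant.
Context (K : fieldType) (R : comNzRingType) (P : lmodType R).
Context (s : K -> R) (h : K -> P).
Implicit Types x y : K.
Context (sM : forall x y, x != 0 -> y != 0 -> s (x * y) = s x * s y).
Context (s_sqr : forall x, x != 0 -> s x * s x = 1).
Context (h_psi1 : forall x, x != 0 -> h x^-1 = - (s (-1) *: h x)).
Context (h_psi2 : forall x, x != 0 -> h x^-1 = - (s x *: h x)).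
Context (h_five : forall x y, x != 0 -> x != 1 -> y != 0 -> y != 1 ->
  h x - h y + s x *: h (y / x)
  - s (x^-1 - 1) *: h ((1 - x^-1) / (1 - y^-1))
  + s (1 - x) *: h ((1 - x) / (1 - y)) = 0).
Local Notation e := (s (-1)).

Definition bloch_sum x : P := h x + e *: h (1 - x).

Let n1 : -1 != 0 :> K. Proof. by rewrite oppr_eq0 oner_eq0. Qed.

Let ne x : x != 1 -> 1 - x != 0. Proof. by rewrite subr_eq0 eq_sym. Qed.

Let ne1 x : x != 0 -> 1 - x != 1.
Proof. by move=> x0; rewrite -subr_eq0 addrAC subrr sub0r oppr_eq0. Qed.

Let sK x (m : P) : x != 0 -> s x *: (s x *: m) = m.
Proof. by move=> x0; rewrite scalerA s_sqr // scale1r. Qed.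

Let s1 : s 1 = 1 := square_character1 sM s_sqr.

Let sV x : x != 0 -> s x^-1 = s x.
Proof. exact: square_characterV sM s_sqr x. Qed.

(** Compare both values of [1/x]. *)
Lemma symb_stable x : x != 0 -> s x *: h x = e *: h x.
Proof. by move=> x0; apply: oppr_inj; rewrite -h_psi1 // h_psi2. Qed.

Let h_inv2 x : x != 0 -> h x + e *: h x^-1 = 0.
Proof. by move=> x0; rewrite h_psi1 // scalerN sK // subrr. Qed.

Lemma five_term_split x y : x != 0 -> x != 1 -> y != 0 -> y != 1 ->
  h x - h y + s x *: h (y / x)
  - (s (1 - x) * s x) *: h ((1 - x) / (1 - y) * (y / x))
  + s (1 - x) *: h ((1 - x) / (1 - y)) = 0.
Proof.
move=> x0 x1 y0 y1; rewrite -[RHS](h_five x0 x1 y0 y1).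
by rewrite cross_ratio_sub1 // (square_character_inv_sub1 sM s_sqr x0 x1).
Qed.

(** In the relation for (1 - x, 1 - y), multiplied by <-1>, the three cross
    ratios are the inverses of those for (x, y) and carry the same
    coefficients, so they cancel by [z] + <-1>[1/z] = 0. *)
Lemma bloch_sum_const x y : x != 0 -> x != 1 -> y != 0 -> y != 1 ->
  bloch_sum x = bloch_sum y.
Proof.
move=> x0 x1 y0 y1; have [p0 q0] := (ne x1, ne y1).
have := five_term_split x0 x1 y0 y1.
have := five_term_split p0 (ne1 x0) q0 (ne1 y0).
rewrite /bloch_sum.
set p := 1 - x in p0 *; set q := 1 - y in q0 *.
have -> : 1 - p = x by rewrite subKr.
have -> : 1 - q = y by rewrite subKr.
have -> : x / y * (q / p) = (p / q * (y / x))^-1.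
  by rewrite invfM !invf_div mulrC.
have -> : q / p = (p / q)^-1 by rewrite invf_div.
have -> : x / y = (y / x)^-1 by rewrite invf_div.
move: (h_inv2 (mulf_neq0 y0 (invr_neq0 x0))).
move: (h_inv2 (mulf_neq0 p0 (invr_neq0 q0))).
have r0 : p / q * (y / x) != 0 by rewrite !mulf_neq0 ?invr_eq0.
move: (h_inv2 r0).
rewrite [s x * s p]mulrC.
move: (p / q * (y / x)) (p / q * (y / x))^-1 => r r'.
move: (y / x) (y / x)^-1 (p / q) (p / q)^-1 => a a' b b' hr hb ha E1 E2.
apply/eqP; rewrite -subr_eq0; apply/eqP.
transitivity ((h x - h y + s x *: h a - (s p * s x) *: h r + s p *: h b) +
  e *: (h p - h q + s p *: h b' - (s p * s x) *: h r' + s x *: h a')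
  - s x *: (h a + e *: h a') + (s p * s x) *: (h r + e *: h r')
  - s p *: (h b + e *: h b')); last first.
  by rewrite ha hb hr E1 E2 !scaler0 !(addr0, subr0).
have -> : s x *: (h a + e *: h a') = s x *: h a + e *: (s x *: h a').
  by rewrite scalerDr !scalerA mulrC.
have -> : s p *: (h b + e *: h b') = s p *: h b + e *: (s p *: h b').
  by rewrite scalerDr !scalerA [s p * e]mulrC.
have -> : (s p * s x) *: (h r + e *: h r') =
    (s p * s x) *: h r + e *: ((s p * s x) *: h r').
  by rewrite scalerDr !scalerA [_ * e]mulrC.
rewrite !(scalerDr, scalerN).
abelian.
Qed.

(** Multiplication by <-1> exchanges the sums at x and at 1 - x. *)
Lemma bloch_sum_stable_N1 x : x != 0 -> x != 1 ->
  e *: bloch_sum x = bloch_sum x.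
Proof.
move=> x0 x1; rewrite {2}(bloch_sum_const x0 x1 (ne x1) (ne1 x0)) /bloch_sum.
rewrite subKr scalerDr sK //; abelian.
Qed.

(** These are the sums at x, 1/x and 1/(1 - x).  All six arguments that occur
    are x, 1 - x, 1 - 1/x and their inverses. *)
Lemma bloch_sum_forms x : x != 0 -> x != 1 ->
  let a := h x in let b := h (1 - x) in let c := h (1 - x^-1) in
  [/\ bloch_sum x = a + e *: b, bloch_sum x = c - a &
      bloch_sum x = - (e *: b) - c].
Proof.
move=> x0 x1 a b c; have p0 := ne x1; split=> //.
  rewrite -bloch_sum_stable_N1 //.
  rewrite (@bloch_sum_const x x^-1) ?invr_eq0 ?invr_eq1 //.
  by rewrite /bloch_sum scalerDr sK // h_psi1 // scalerN sK // addrC.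
have y0 : (1 - x)^-1 != 0 by rewrite invr_eq0.
have y1 : (1 - x)^-1 != 1 by rewrite invr_eq1 ne1.
rewrite (bloch_sum_const x0 x1 y0 y1) /bloch_sum h_psi1 //.
have -> : 1 - (1 - x)^-1 = (1 - x^-1)^-1.
  by field; rewrite x0 p0 -opprB oppr_eq0 p0.
have z0 : 1 - x^-1 != 0 by rewrite ne // invr_eq1.
by rewrite h_psi1 // scalerN sK.
Qed.

Lemma bloch_sum3 x : x != 0 -> x != 1 -> bloch_sum x *+ 3 = 0.
Proof.
move=> x0 x1; have [A B C] := bloch_sum_forms x0 x1.
by rewrite !mulrS mulr0n {1}A {1}B C; abelian.
Qed.

(** [symb_stable] at 1 - 1/x, whose class is <-1><1 - x><x>. *)
Lemma symb_sub_inv_stable x : x != 0 -> x != 1 ->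
  (s (1 - x) * s x) *: h (1 - x^-1) = h (1 - x^-1).
Proof.
move=> x0 x1; have p0 := ne x1.
have z0 : 1 - x^-1 != 0 by rewrite ne // invr_eq1.
have zE : 1 - x^-1 = - 1 * ((1 - x) * x^-1).
  by rewrite mulrBl divff // mul1r mulN1r opprB.
have := symb_stable z0; rewrite {1}zE !sM ?mulf_neq0 ?invr_eq0 // sV //.
by rewrite -scalerA => /(congr1 ( *:%R e)); rewrite !sK.
Qed.

(** Expand <x>C through [x] and [1 - 1/x], and <1 - x>C through [1 - x] and
    [1 - 1/x].  On [x] and on [1 - x] the scalar acts as <-1>, and both scalars
    agree on [1 - 1/x]. *)
Let bloch_sum_relation x : x != 0 -> x != 1 ->
  s x *: bloch_sum x + s (1 - x) *: bloch_sum x + bloch_sum x = 0.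
Proof.
move=> x0 x1; have [A B C] := bloch_sum_forms x0 x1; have p0 := ne x1.
have stz : s (1 - x) *: h (1 - x^-1) = s x *: h (1 - x^-1).
  by rewrite -{2}symb_sub_inv_stable // scalerA mulrCA s_sqr // mulr1.
have sb : s (1 - x) *: h (1 - x) = e *: h (1 - x) by apply: symb_stable.
rewrite {1}B {1}C -bloch_sum_stable_N1 // A.
rewrite !(scalerDr, scalerN) symb_stable // stz.
have -> : s (1 - x) *: (e *: h (1 - x)) = e *: (e *: h (1 - x)).
  by rewrite scalerA mulrC -scalerA sb.
abelian.
Qed.

(** Write C for the constant.  The relation (<y> + <1 - y> + 1)C = 0 holds for y
    and for 1/y.  The class of 1 - 1/y acts on C as <1 - y><y>, so the two
    relations differ by <1 - y><y>C = <1 - y>C. *)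
Lemma bloch_sum_stable x y : x != 0 -> x != 1 -> y != 0 ->
  s y *: bloch_sum x = bloch_sum x.
Proof.
move=> x0 x1 y0; have [->|y1] := eqVneq y 1; first by rewrite s1 scale1r.
rewrite (bloch_sum_const x0 x1 y0 y1).
have p0 := ne y1; set C := bloch_sum y.
have yV0 : y^-1 != 0 by rewrite invr_eq0.
have yV1 : y^-1 != 1 by rewrite invr_eq1.
have E1 := bloch_sum_relation y0 y1; have := bloch_sum_relation yV0 yV1.
rewrite (bloch_sum_const yV0 yV1 y0 y1) -/C sV //.
have -> : 1 - y^-1 = - 1 * ((1 - y) * y^-1).
  by rewrite mulrBl divff // mul1r mulN1r opprB.
rewrite !sM ?mulf_neq0 ?invr_eq0 // sV // [e * _]mulrC -scalerA.
rewrite bloch_sum_stable_N1 // -/C => E2.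
have E3 : s (1 - y) *: (s y *: C) = s (1 - y) *: C.
  rewrite scalerA; apply: (addrI (s y *: C)); apply: (addIr C).
  by rewrite E2 E1.
by rewrite -[LHS](sK _ p0) E3 sK.
Qed.
End BlochConstant.

(** * The five-term relation for the specialization *)

(** The predicates pos and unt stand for v(x) > 0 and v(x) = 0, and v(x) < 0 is
    expressed as pos x^-1.  The map j is m |-> 1 (x) m.  It is linear over the
    units only, so classes of nonunits stay outside j. *)
Section SpecializationCases.
Context (F K : fieldType) (RF RK : comNzRingType).
Context (M : lmodType RF) (P : lmodType RK).
Context (sF : F -> RF) (sK : K -> RK) (j : {additive P -> M}).
Context (pos unt : pred F) (res : F -> K) (h : K -> P) (C : P) (tau : F -> P).
Implicit Types (x y z t : F) (a b : K).
Context (sFM : forall x y, x != 0 -> y != 0 -> sF (x * y) = sF x * sF y).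
Context (sF_sqr : forall x, x != 0 -> sF x * sF x = 1).
Context (sKM : forall a b, a != 0 -> b != 0 -> sK (a * b) = sK a * sK b).
Context (sK_sqr : forall a, a != 0 -> sK a * sK a = 1).
Context (act : forall x m, unt x -> sF x *: j m = j (sK (res x) *: m)).
Context (pos_neq0 : forall x, pos x -> x != 0).
Context (unt_neq0 : forall x, unt x -> x != 0).
Context (place_cases : forall x, x != 0 -> [\/ pos x, unt x | pos x^-1]).
Context (posM : forall x y, pos x -> pos y -> pos (x * y)).
Context (posU : forall x y, pos x -> unt y -> pos (x * y)).
Context (untM : forall x y, unt x -> unt y -> unt (x * y)).
Context (untV : forall x, unt x -> unt x^-1).
Context (untN1 : unt (-1)).
Context (resM : forall x y, unt x -> unt y -> res (x * y) = res x * res y).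
Context (resV : forall x, unt x -> res x^-1 = (res x)^-1).
Context (res_neq0 : forall x, unt x -> res x != 0).
Context (resN1 : res (-1) = -1).
Context (pos_sub1 : forall x, pos x -> unt (1 - x) /\ res (1 - x) = 1).
Context (unt_sub1 : forall x, unt x -> x != 1 ->
  (res x = 1 /\ pos (1 - x)) \/
  [/\ res x != 1, unt (1 - x) & res (1 - x) = 1 - res x]).
Context (h1 : h 1 = 0).
Context (h_psi1 : forall a, a != 0 -> h a^-1 = - (sK (-1) *: h a)).
Context (h_psi2 : forall a, a != 0 -> h a^-1 = - (sK a *: h a)).
Context (h_five : forall a b, a != 0 -> a != 1 -> b != 0 -> b != 1 ->
  h a - h b + sK a *: h (b / a)
  - sK (a^-1 - 1) *: h ((1 - a^-1) / (1 - b^-1))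
  + sK (1 - a) *: h ((1 - a) / (1 - b)) = 0).
Context (CE : forall a, a != 0 -> a != 1 -> bloch_sum sK h a = C).
Context (C3 : C *+ 3 = 0).
Context (C_stable : forall a, a != 0 -> sK a *: C = C).
Context (tau_pos : forall x, pos x -> tau x = C).
Context (tau_neg : forall x, pos x^-1 -> tau x = - C).
Context (tau_unt : forall x, unt x -> tau x = h (res x)).

Let S x : M := j (tau x).
Let c : M := j C.

Let negM x y : pos x^-1 -> pos y^-1 -> pos (x * y)^-1.
Proof. by move=> x0 y0; rewrite invfM; apply: posM. Qed.
Let negU x y : pos x^-1 -> unt y -> pos (x * y)^-1.
Proof. by move=> x0 y0; rewrite invfM; apply: posU => //; apply: untV. Qed.
Let Upos x y : unt x -> pos y -> pos (x * y).
Proof. by move=> x0 y0; rewrite mulrC; apply: posU. Qed.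
Let Uneg x y : unt x -> pos y^-1 -> pos (x * y)^-1.
Proof. by move=> x0 y0; rewrite mulrC; apply: negU. Qed.
Let posVV x : pos x -> pos x^-1^-1. Proof. by rewrite invrK. Qed.
Let neg_neq0 x : pos x^-1 -> x != 0.
Proof. by move/pos_neq0; rewrite invr_eq0. Qed.

Let S_pos x : pos x -> S x = c. Proof. by move=> ?; rewrite /S tau_pos. Qed.
Let S_neg x : pos x^-1 -> S x = - c.
Proof. by move=> ?; rewrite /S tau_neg // raddfN. Qed.
Let S_unt x : unt x -> S x = j (h (res x)).
Proof. by move=> ?; rewrite /S tau_unt. Qed.
Let S_res1 x : unt x -> res x = 1 -> S x = 0.
Proof. by move=> ? e; rewrite S_unt // e h1 raddf0. Qed.

Let c3 : c + c + c = 0.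
Proof.
by have := congr1 j C3; rewrite !mulrS mulr0n addr0 raddf0 !raddfD addrA.
Qed.

Let sK1 : sK 1 = 1 := square_character1 sKM sK_sqr.

Let act1 t m : unt t -> res t = 1 -> sF t *: j m = j m.
Proof. by move=> ? e; rewrite act // e sK1 scale1r. Qed.

Let act1S t x : unt t -> res t = 1 -> sF t *: S x = S x.
Proof. exact: act1. Qed.

Let actC t : unt t -> sF t *: c = c.
Proof. by move=> ut; rewrite act // C_stable // res_neq0. Qed.

Let S_mul1 t z : unt t -> res t = 1 -> z != 0 -> S (t * z) = S z.
Proof.
move=> ut rt /place_cases[] hz.
- by rewrite !S_pos //; apply: Upos.
- by rewrite !S_unt ?resM ?rt ?mul1r //; apply: untM.
- by rewrite !S_neg //; apply: Uneg.
Qed.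

Let S_inv t z : unt t -> res t = -1 -> z != 0 -> S z + sF t *: S z^-1 = 0.
Proof.
move=> ut rt /place_cases[] hz.
- by rewrite S_pos // S_neg ?invrK // scalerN actC // subrr.
- rewrite !S_unt ?resV //; last exact: untV.
  rewrite h_psi1 ?res_neq0 // raddfN scalerN act // rt scalerA sK_sqr.
    by rewrite scale1r subrr.
  by rewrite oppr_eq0 oner_eq0.
- by rewrite S_neg // S_pos // actC // addNr.
Qed.

(** The four possible types of the pair (x, 1 - x).  In the last one, 1 - x is
    written as t x because only the unit t has a residue. *)
Variant place_spec x : F -> Prop :=
| PlacePos p of pos x & unt p & res p = 1 : place_spec x p
| PlaceUnt p of unt x & res x != 1 & unt p & res p = 1 - res x : place_spec x p
| PlaceOne p of unt x & res x = 1 & pos p : place_spec x p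
| PlaceNeg t of pos x^-1 & unt t & res t = -1 : place_spec x (t * x).

Lemma placeP x : x != 0 -> x != 1 -> place_spec x (1 - x).
Proof.
move=> x0 x1; have [hx|hx|hx] := place_cases x0.
- by have [? ?] := pos_sub1 hx; apply: PlacePos.
- have [[? ?]|[? ? ?]] := unt_sub1 hx x1; first exact: PlaceOne.
  exact: PlaceUnt.
have [up rp] := pos_sub1 hx.
have -> : 1 - x = (- 1 * (1 - x^-1)) * x.
  by rewrite mulN1r opprB mulrBl mulVf // mul1r.
by apply: PlaceNeg; rewrite // ?resM ?resN1 ?rp ?mulr1 //; apply: untM.
Qed.

Definition split_five x y p q : M :=
  S x - S y + sF x *: S (y / x) - sF p *: (sF x *: S (p / q * (y / x)))
  + sF p *: S (p / q).

Let sFK x (m : M) : x != 0 -> sF x *: (sF x *: m) = m.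
Proof. by move=> x0; rewrite scalerA sF_sqr // scale1r. Qed.

Let sFC x y (m : M) : sF x *: (sF y *: m) = sF y *: (sF x *: m).
Proof. by rewrite !scalerA mulrC. Qed.

Let divU x y : unt x -> unt y -> unt (x / y).
Proof. by move=> ux uy; apply/untM/untV. Qed.

(** Since p has residue 1, its class acts trivially.  The four cases of y need,
    in this order: nothing but residues; [1/(1 - y)] = [y] - C; nothing;
    3C = 0. *)
Lemma split_five_pos x y p : pos x -> unt p -> res p = 1 -> y != 0 -> y != 1 ->
  split_five x y p (1 - y) = 0.
Proof.
move=> px up rp y0 y1; have x0 := pos_neq0 px.
have yx0 : y / x != 0 by rewrite mulf_neq0 // invr_eq0.
rewrite /split_five [S x]S_pos // sFC !(act1S _ up rp).
case: (placeP y0 y1) => [q py uq rq|q uy ry uq rq|q uy ry pq|t ny ut rt].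
- have upq := divU up uq.
  have rpq : res (p / q) = 1.
    by rewrite resM ?resV ?rp ?rq ?mul1r ?invr1 //; apply: untV.
  rewrite [S y]S_pos // [S (p / q * _)]S_mul1 // [S (p / q)]S_res1 //; abelian.
- have nyx : pos (y / x)^-1 by apply: Uneg => //; apply: posVV.
  have upq := divU up uq.
  rewrite [S (y / x)]S_neg // [S (_ * _)]S_neg; last exact: Uneg.
  rewrite !S_unt // resM ?resV ?rp ?rq ?mul1r //; last exact: untV.
  have ry0 := res_neq0 uy.
  have p0 : 1 - res y != 0 by rewrite subr_eq0 eq_sym.
  have -> : h (1 - res y)^-1 = h (res y) - C.
    by rewrite h_psi1 // -(CE ry0 ry); rewrite /bloch_sum; abelian.
  rewrite raddfB; abelian.
- have nyx : pos (y / x)^-1 by apply: Uneg => //; apply: posVV.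
  have npq : pos (p / q)^-1 by apply: Uneg => //; apply: posVV.
  rewrite [S y]S_res1 // [S (y / x)]S_neg // [S (_ * _)]S_neg; last exact: negM.
  rewrite [S (p / q)]S_neg //; abelian.
- have nyx : pos (y / x)^-1 by apply: negM => //; apply: posVV.
  have ppq : pos (p / (t * y)).
    by rewrite invfM; apply: Upos => //; apply: Upos => //; apply: untV.
  have -> : p / (t * y) * (y / x) = (p / t) * x^-1.
    by field; rewrite y0 x0 unt_neq0.
  rewrite [S y]S_neg // [S (y / x)]S_neg // [S (_ * _)]S_neg; last first.
    by apply: Uneg; [exact: divU|exact: posVV].
  rewrite [S (p / _)]S_pos //.
  have -> : c - - c + sF x *: - c - sF x *: - c + c = c + c + c by abelian.
  exact: c3.
Qed.

(** All classes of scalars are classes of units.  The cases of y need, in this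
    order: <p>[p] = <-1>[p] and C = [x] + <-1>[1 - x]; the five-term relation of
    the residue field; [1/x] = -<x>[x]; the form [1 - 1/x] - [x] of C. *)
Lemma split_five_unt x y p :
  unt x -> res x != 1 -> unt p -> res p = 1 - res x ->
  y != 0 -> y != 1 -> split_five x y p (1 - y) = 0.
Proof.
move=> ux rx up rp y0 y1; have x0 := unt_neq0 ux.
have rx0 := res_neq0 ux; have rp0 := res_neq0 up.
rewrite /split_five.
case: (placeP y0 y1) => [q py uq rq|q uy ry uq rq|q uy ry pq|t ny ut rt].
- have upq := divU up uq.
  have pyx : pos (y / x) by apply: posU => //; apply: untV.
  have rpq : res (p / q) = res p.
    by rewrite resM ?resV ?rq ?invr1 ?mulr1 //; apply: untV.
  rewrite [S y]S_pos // [S (y / x)]S_pos // [S (_ * _)]S_pos; last exact: Upos.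
  rewrite !actC // !S_unt // act // rpq (symb_stable h_psi1 h_psi2) // rp.
  have /(congr1 j) := CE rx0 rx; rewrite /bloch_sum raddfD /= -/c => <-.
  abelian.
- have uyx := divU uy ux; have upq := divU up uq.
  rewrite !S_unt ?resM ?resV //; try by [apply: untM|apply: untV].
  rewrite !act // -!(raddfB, raddfD).
  have := five_term_split sKM sK_sqr h_five rx0 rx (res_neq0 uy) ry.
  by rewrite -scalerA rp rq => ->; rewrite raddf0.
- have uyx := divU uy ux.
  have npq : pos (p / q)^-1 by apply: Uneg => //; apply: posVV.
  rewrite [S y]S_res1 // [S (p / q)]S_neg //.
  rewrite [S (p / q * _)]S_neg; last exact: negU.
  rewrite !scalerN !actC // !S_unt //.
  rewrite resM ?resV ?ry ?mul1r //; last exact: untV.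
  rewrite act // h_psi2 // scalerN scalerA sK_sqr // scale1r raddfN; abelian.
- have nyx : pos (y / x)^-1 by apply: negU => //; apply: untV.
  have ppq : pos (p / (t * y)).
    by rewrite invfM; apply: Upos => //; apply: Upos => //; apply: untV.
  have -> : p / (t * y) * (y / x) = (p / x) / t.
    by field; rewrite y0 x0 unt_neq0.
  have upx := divU up ux.
  rewrite [S y]S_neg // [S (y / x)]S_neg // [S (p / (_ * _))]S_pos //.
  rewrite !scalerN !actC // !S_unt //; last exact: divU.
  have -> : res (p / x / t) = 1 - (res x)^-1.
    rewrite !resM ?resV ?rt ?invrN ?invr1 ?rp //; try exact: untV.
    by rewrite mulrN1 mulrBl mul1r divff // opprB.
  rewrite !act // scalerA rp (symb_sub_inv_stable sKM sK_sqr h_psi1 h_psi2) //.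
  have [] := bloch_sum_forms sKM sK_sqr h_psi1 h_five rx0 rx.
  rewrite CE // => _ /(congr1 j); rewrite raddfB -/c => -> _; abelian.
Qed.

(** Here <x> acts trivially, and <p> is the class of an element that may be a
    nonunit, so the two terms with coefficient <p> have to cancel.  They do:
    if y has residue 1, their arguments differ by the factor y/x, a unit with
    residue 1; otherwise both arguments have positive valuation. *)
Lemma split_five_one x y p : unt x -> res x = 1 -> pos p -> y != 0 -> y != 1 ->
  split_five x y p (1 - y) = 0.
Proof.
move=> ux rx pp y0 y1; have x0 := unt_neq0 ux; have p0 := pos_neq0 pp.
rewrite /split_five !(act1S _ ux rx) [S x]S_res1 //.
case: (placeP y0 y1) => [q py uq rq|q uy ry uq rq|q uy ry pq|t ny ut rt].
- have pyx : pos (y / x) by apply: posU => //; apply: untV.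
  have ppq : pos (p / q) by apply: posU => //; apply: untV.
  rewrite [S y]S_pos // [S (y / x)]S_pos //.
  rewrite [S (p / q * _)]S_pos; last exact: posM.
  rewrite [S (p / q)]S_pos //; abelian.
- have uyx := divU uy ux.
  have ppq : pos (p / q) by apply: posU => //; apply: untV.
  have ryx : res (y / x) = res y.
    by rewrite resM ?resV ?rx ?invr1 ?mulr1 //; apply: untV.
  rewrite [S (p / q * _)]S_pos; last exact: posU.
  rewrite [S (p / q)]S_pos // !S_unt // ryx; abelian.
- have uyx := divU uy ux.
  have ryx : res (y / x) = 1.
    by rewrite resM ?resV ?rx ?ry ?invr1 ?mulr1 //; apply: untV.
  have pq0 : p / q != 0 by rewrite mulf_neq0 // invr_eq0 pos_neq0.
  rewrite [p / q * _]mulrC [S (y / x * _)]S_mul1 // [S y]S_res1 //.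
  rewrite [S (y / x)]S_res1 //; abelian.
- have nyx : pos (y / x)^-1 by apply: negU => //; apply: untV.
  have ppq : pos (p / (t * y)).
    by rewrite invfM; apply: posM => //; apply: Upos => //; apply: untV.
  have -> : p / (t * y) * (y / x) = p * (x^-1 * t^-1).
    by field; rewrite y0 x0 unt_neq0.
  rewrite [S y]S_neg // [S (y / x)]S_neg // [S (p / _)]S_pos //.
  rewrite [S (p * _)]S_pos; last by apply: posU => //; apply: untM; apply: untV.
  abelian.
Qed.

(** Here <p> = <t><x> with <t> acting as <-1>, so the class <x> appears twice in
    the fourth term and disappears from it.  The cases of y need, in this
    order: 3C = 0; the form [1 - 1/y] - [y] of C; nothing; the relation
    [z] + <-1>[1/z] = 0 at z = y/x. *)
Lemma split_five_neg x y t : pos x^-1 -> unt t -> res t = -1 ->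
  y != 0 -> y != 1 -> split_five x y (t * x) (1 - y) = 0.
Proof.
move=> nx ut rt y0 y1; have x0 := neg_neq0 nx; have t0 := unt_neq0 ut.
rewrite /split_five [S x]S_neg // sFM // -!scalerA sFK //.
case: (placeP y0 y1) => [q py uq rq|q uy ry uq rq|q uy ry pq|u ny uu ru].
- have q0 := unt_neq0 uq.
  have -> : t * x / q * (y / x) = t / q * y by field; rewrite x0 q0.
  have -> : t * x / q = t / q * x by field; rewrite q0.
  have utq := divU ut uq.
  rewrite [S y]S_pos // [S (y / x)]S_pos; last exact: posM.
  rewrite [S (t / q * y)]S_pos; last exact: Upos.
  rewrite [S (t / q * x)]S_neg; last exact: Uneg.
  rewrite !scalerN (sFC t x) !(actC ut).
  have -> : - c - c + sF x *: c - c - sF x *: c = - (c + c + c) by abelian.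
  by rewrite c3 oppr0.
- have q0 := unt_neq0 uq.
  have -> : t * x / q * (y / x) = t * (y / q) by field; rewrite x0 q0.
  have -> : t * x / q = t / q * x by field; rewrite q0.
  have [utq uyq] := (divU ut uq, divU uy uq).
  have ry0 := res_neq0 uy.
  rewrite [S (y / x)]S_pos; last exact: Upos.
  rewrite [S (t / q * x)]S_neg; last exact: Uneg.
  rewrite !S_unt //; last exact: untM.
  rewrite !scalerN (sFC t x) !(actC ut) act // rt.
  have -> : res (t * (y / q)) = (1 - (res y)^-1)^-1.
    rewrite !resM ?resV ?rt ?rq //; last exact: untV.
    have p0 : 1 - res y != 0 by rewrite subr_eq0 eq_sym.
    by field; rewrite ry0 p0 -opprB oppr_eq0 p0.
  rewrite h_psi1 ?subr_eq0 1?eq_sym ?invr_eq1 //.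
  rewrite scalerN scalerA sK_sqr; last first.
    by rewrite oppr_eq0 oner_eq0.
  have [] := bloch_sum_forms sKM sK_sqr h_psi1 h_five ry0 ry.
  rewrite CE // scale1r => _ /(congr1 j).
  rewrite raddfB raddfN -/c => -> _; abelian.
- have q0 := pos_neq0 pq.
  have -> : t * x / q * (y / x) = t * y / q by field; rewrite x0 q0.
  rewrite [S y]S_res1 // [S (y / x)]S_pos; last exact: Upos.
  rewrite [S (t * y / q)]S_neg; last by apply: Uneg; [exact: untM|exact: posVV].
  rewrite [S (t * x / q)]S_neg; last by apply: negM; [exact: Uneg|exact: posVV].
  rewrite !scalerN (sFC t x) !(actC ut); abelian.
- have u0 := unt_neq0 uu.
  have utu := divU ut uu.
  have rtu : res (t / u) = 1.
    rewrite resM ?resV ?rt ?ru //; last exact: untV.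
    by rewrite divff // oppr_eq0 oner_eq0.
  have -> : t * x / (u * y) * (y / x) = t / u by field; rewrite x0 u0 y0.
  have -> : t * x / (u * y) = t / u * (y / x)^-1 by field; rewrite x0 u0 y0.
  have yx0 : y / x != 0 by rewrite mulf_neq0 // invr_eq0.
  rewrite [S (t / u * _)]S_mul1 ?invr_eq0 // [S (t / u)]S_res1 // [S y]S_neg //.
  have /(congr1 ( *:%R (sF x))) := S_inv ut rt yx0.
  rewrite scaler0 scalerDr (sFC t x) scaler0 => E; rewrite -[RHS]E.
  abelian.
Qed.

Lemma specialization_five_term x y : x != 0 -> x != 1 -> y != 0 -> y != 1 ->
  S x - S y + sF x *: S (y / x)
  - sF (x^-1 - 1) *: S ((1 - x^-1) / (1 - y^-1))
  + sF (1 - x) *: S ((1 - x) / (1 - y)) = 0.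
Proof.
move=> x0 x1 y0 y1; rewrite cross_ratio_sub1 //.
rewrite (square_character_inv_sub1 sFM sF_sqr x0 x1) -scalerA.
rewrite -/(split_five x y (1 - x) (1 - y)).
case: (placeP x0 x1) => [p ? ? ?|p ? ? ? ?|p ? ? ?|t ? ? ?].
- exact: split_five_pos.
- exact: split_five_unt.
- exact: split_five_one.
- exact: split_five_neg.
Qed.

End SpecializationCases.

(** * Small fields *)

Section FieldSize.
Context (F : fieldType).
Implicit Types s : seq F.

Lemma card_uniq s : uniq s -> ([set x | x \in s] #= `I_(size s))%card.
Proof.
move=> us; have -> : [set x | x \in s] = [set` [fset x in s]%fset].
  by apply/seteqP; split=> x /=; rewrite in_fset.
by apply/card_eq_fsetP; rewrite card_fseq undup_id.
Qed.

Lemma card_ge_uniq s : uniq s -> card_ge F (size s).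
Proof.
move=> us; apply: (@card_le_trans _ _ _ [set x | x \in s]).
  by have := card_uniq us; rewrite card_eq_le => /andP[].
exact: subset_card_le.
Qed.

Lemma card_is_uniq s : uniq s -> (forall x, x \in s) -> card_is F (size s).
Proof.
move=> us hs; rewrite /card_is -[setT](_ : [set x | x \in s] = _).
  exact: card_uniq.
by apply/seteqP; split=> x //= _.
Qed.

Lemma card_is_ge n m : card_is F n -> card_ge F m -> (m <= n)%N.
Proof.
rewrite /card_is card_eq_le => /andP[Fn _] Fm.
by rewrite -card_le_II; apply: card_le_trans Fm Fn.
Qed.

Lemma card_is_leq n s : card_is F n -> uniq s -> (size s <= n)%N.
Proof. by move=> Fn /card_ge_uniq; apply: card_is_ge. Qed.

Lemma card_is2P (x : F) : card_is F 2 -> x != 0 -> x = 1.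
Proof.
move=> F2 x0; apply/eqP; apply: contraT => x1.
have /(card_is_leq F2) : uniq [:: 0; 1; x].
  by rewrite /= !inE !negb_or !(eq_sym _ x) eq_sym oner_neq0 x0 x1.
by [].
Qed.

Lemma not_card_is2 : ~ card_is F 2 -> exists x : F, x != 0 /\ x != 1.
Proof.
move=> F2; apply: contrapT => nx; apply: F2.
have u2 : uniq [:: 0 : F; 1] by rewrite /= inE eq_sym oner_neq0.
apply: (card_is_uniq u2) => x; rewrite !inE; apply: contraT.
by rewrite negb_or => /andP[x0 x1]; case: nx; exists x.
Qed.

Lemma small_field_eq (x y : F) : ~ card_ge F 4 ->
  x != 0 -> x != 1 -> y != 0 -> y != 1 -> x = y.
Proof.
move=> F4 x0 x1 y0 y1; apply/eqP; apply: contraT => xy; case: F4.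
have /card_ge_uniq : uniq [:: 0; 1; x; y].
  rewrite /= !inE !negb_or !(eq_sym _ y) [y == x]eq_sym !(eq_sym _ x).
  by rewrite eq_sym oner_neq0 x0 x1 y0 y1 xy.
by [].
Qed.

End FieldSize.

(** * Relations in RPhat *)

Lemma linear_five_term (R : nzRingType) (V W : lmodType R) (f : {linear V -> W})
    (a b c : R) (m1 m2 m3 m4 m5 : V) (n1 n2 n3 n4 n5 : W) :
  f m1 = n1 -> f m2 = n2 -> f m3 = n3 -> f m4 = n4 -> f m5 = n5 ->
  f (m1 - m2 + a *: m3 - b *: m4 + c *: m5) =
  n1 - n2 + a *: n3 - b *: n4 + c *: n5.
Proof. by move=> <- <- <- <- <-; rewrite !(raddfD, raddfN) /= !linearZ. Qed.

Lemma linear_comb_ker (R : nzRingType) (V W : lmodType R) (f : {linear V -> W})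
    (a b : R) (m1 m2 m3 : V) :
  f m3 = 0 -> f (m1 + a *: m2 + b *: m3) = f m1 + a *: f m2.
Proof. by move=> m30; rewrite !raddfD /= !linearZ /= m30 scaler0 addr0. Qed.

Section RelationsModPsi.
Context (K : fieldType).
Local Notation P := (RPhat K).
Local Notation e := (sqcl (-1) : sqring K).

Definition hat_symb (x : K) : P := RPhat_pi K (symb x).
Definition hat_const : P := RPhat_pi K (bloch_const K).

Lemma hat_symb1 : hat_symb 1 = 0.
Proof.
rewrite /hat_symb /symb quotmod_pi_gen0; first by rewrite raddf0.
exact: RP_one.
Qed.

Lemma RPhat_psi1 x : x != 0 -> RPhat_pi K (psi1 x) = 0.
Proof.
move=> nx; apply: quotmod_pi_gen0; exists (psi1 x); last first.
  by exists 0; [exact: submod_gen0|rewrite addr0].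
by apply: submod_gen_sub; exists x.
Qed.

Lemma RPhat_psi2 x : x != 0 -> RPhat_pi K (psi2 x) = 0.
Proof.
move=> nx; apply: quotmod_pi_gen0; exists 0; first exact: submod_gen0.
exists (psi2 x); last by rewrite add0r.
by apply: submod_gen_sub; exists x.
Qed.

Lemma hat_symbV_psi1 x : x != 0 -> hat_symb x^-1 = - (e *: hat_symb x).
Proof.
move=> nx; apply/eqP; rewrite -addr_eq0; apply/eqP.
have nV : x^-1 != 0 by rewrite invr_eq0.
by have := RPhat_psi1 nV; rewrite /psi1 invrK raddfD /= linearZ.
Qed.

Lemma hat_symbV_psi2 x : x != 0 -> hat_symb x^-1 = - (sqcl x *: hat_symb x).
Proof.
move=> nx; have [->|n1] := eqVneq x 1.
  by rewrite invr1 hat_symb1 scaler0 oppr0.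
have n1x : 1 - x != 0 by rewrite subr_eq0 eq_sym.
have := RPhat_psi2 nx; rewrite /psi2 (negPf n1) => h.
apply/eqP; rewrite -addr_eq0; apply/eqP.
rewrite linearZ /= raddfD /= linearZ /= -/(hat_symb _) -/(hat_symb _) in h.
by rewrite addrC -[LHS]scale1r -(sqcl_sqr n1x) -scalerA h scaler0.
Qed.

Lemma hat_five_term_ge4 x y : card_ge K 4 ->
  x != 0 -> x != 1 -> y != 0 -> y != 1 ->
  hat_symb x - hat_symb y + sqcl x *: hat_symb (y / x)
  - sqcl (x^-1 - 1) *: hat_symb ((1 - x^-1) / (1 - y^-1))
  + sqcl (1 - x) *: hat_symb ((1 - x) / (1 - y)) = 0.
Proof.
move=> c4 x0 x1 y0 y1.
have h : quotmod_pi (@RP_rel K) (five_term x y) = 0.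
  by apply: quotmod_pi_gen0; apply: RP_five.
have := congr1 (RPhat_pi K) h; rewrite raddf0 => <-.
apply: esym; apply: etrans (congr1 (RPhat_pi K) _) _.
  exact: (linear_five_term (f := quotmod_pi (@RP_rel K)) _ _ _ erefl erefl erefl
    erefl erefl).
exact: (linear_five_term (f := RPhat_pi K) _ _ _ erefl erefl erefl erefl erefl).
Qed.

(** Over a field with at most three elements x and y coincide, and then the
    relation only says [1] = 0. *)
Lemma hat_five_term x y : x != 0 -> x != 1 -> y != 0 -> y != 1 ->
  hat_symb x - hat_symb y + sqcl x *: hat_symb (y / x)
  - sqcl (x^-1 - 1) *: hat_symb ((1 - x^-1) / (1 - y^-1))
  + sqcl (1 - x) *: hat_symb ((1 - x) / (1 - y)) = 0.
Proof.
move=> x0 x1 y0 y1.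
have [K4|K4] := pselect (card_ge K 4); first exact: hat_five_term_ge4.
have xV : 1 - x^-1 != 0 by rewrite subr_eq0 eq_sym invr_eq1.
have x1' : 1 - x != 0 by rewrite subr_eq0 eq_sym.
rewrite -(small_field_eq K4 x0 x1 y0 y1) (divff x0) (divff xV) (divff x1').
by rewrite hat_symb1 !scaler0 subrr oppr0 !addr0.
Qed.

(** In the field with three elements x = -1 is the only choice, 1 - x = 1/x, and
    both sides are values of psi_1. *)
Lemma hat_constE x : x != 0 -> x != 1 ->
  bloch_sum (@sqcl K) hat_symb x = hat_const.
Proof.
move=> x0 x1; rewrite /hat_const /bloch_const.
case: pselect => [K2|K2]; first by rewrite (card_is2P K2 x0) eqxx in x1.
case: pselect => [K3|K3].
  have n1 : -1 != 0 :> K by exact: N1_neq0.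
  rewrite RPhat_psi1 // /bloch_sum.
  have K4 : ~ card_ge K 4 by move/(card_is_ge K3).
  have p0 : 1 - x != 0 by rewrite subr_eq0 eq_sym.
  have p1 : 1 - x != 1 by rewrite -subr_eq0 addrAC subrr sub0r oppr_eq0.
  have v0 : x^-1 != 0 by rewrite invr_eq0.
  have v1 : x^-1 != 1 by rewrite invr_eq1.
  rewrite (small_field_eq K4 p0 p1 v0 v1).
  by rewrite hat_symbV_psi1 // scalerN scalerA sqclN1_sqr scale1r subrr.
case: xgetP => [y _ [y0 y1]|nx]; last first.
  by have [z hz] := not_card_is2 K2; case: (nx z).
rewrite (bloch_sum_const (@sqclM K) (@sqcl_sqr K) hat_symbV_psi1 hat_five_term
  x0 x1 y0 y1).
exact: esym (linear_comb_ker (f := RPhat_pi K) _ _ _ _ (RPhat_psi1 y0)).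
Qed.

Definition hat_none : P := RPhat_pi K (quotmod_pi (@RP_rel K) << None >>).

Lemma hat_const_card2 : card_is K 2 -> hat_const = hat_none.
Proof.
move=> K2; rewrite /hat_const /bloch_const.
by case: (pselect (card_is K 2)) => [K2'|nK2]; [reflexivity|case: (nK2 K2)].
Qed.

Lemma hat_none0 : ~ card_is K 2 -> hat_none = 0.
Proof.
move=> K2; rewrite /hat_none (quotmod_pi_gen0 (RP_noC K2)); exact: raddf0.
Qed.

Lemma hat_const3 : hat_const *+ 3 = 0.
Proof.
have [K2|/not_card_is2[x [x0 x1]]] := pselect (card_is K 2); last first.
  rewrite -(hat_constE x0 x1); apply: bloch_sum3 => //.
  - exact: (@sqclM K).
  - exact: (@sqcl_sqr K).
  - exact: hat_symbV_psi1.
  - exact: hat_five_term.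
rewrite (hat_const_card2 K2).
have E : quotmod_pi (@RP_rel K) (<< None >> *+ 3) = 0.
  by apply: quotmod_pi_gen0; apply: RP_F2.
rewrite -(raddfMn (RPhat_pi K)) -(raddfMn (quotmod_pi (@RP_rel K))).
exact: etrans (congr1 (RPhat_pi K) E) (raddf0 _).
Qed.

Lemma hat_const_stable x : x != 0 -> sqcl x *: hat_const = hat_const.
Proof.
move=> x0; have [->|x1] := eqVneq x 1; first by rewrite sqcl1 scale1r.
rewrite -(hat_constE x0 x1); apply: bloch_sum_stable => //.
- exact: (@sqclM K).
- exact: (@sqcl_sqr K).
- exact: hat_symbV_psi1.
- exact: hat_symbV_psi2.
- exact: hat_five_term.
Qed.

End RelationsModPsi.

(** * Units, residues and the tensor product *)

Section Place.
Context (F : fieldType) (G : orderedAbType) (v : valuation F G).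
Implicit Types (x y z : F) (u w : mulgrp F).

(** The condition x != 0 excludes the element 0 of the maximal ideal, which has
    no square class. *)
Definition place_pos : pred F := fun x => (x != 0) && (x \in vmax v).
Definition place_unit : pred F := fun x => (x \in vring v) && (x \notin vmax v).

Lemma place_posE u : place_pos (val u) = (0 < v u).
Proof. by rewrite /place_pos vmaxE (valP u). Qed.

Lemma place_unitE u : place_unit (val u) = (v u == 0).
Proof. by rewrite /place_unit vringE vmaxE oab_ltNge negbK eq_le andbC. Qed.

Lemma place_pos_neq0 x : place_pos x -> x != 0.
Proof. by case/andP. Qed.

Lemma place_unit_neq0 x : place_unit x -> x != 0.
Proof. by case/andP=> _; apply: contraNneq => ->; exact: vmax0. Qed.

Lemma neq0_val x : x != 0 -> exists u, x = val u.
Proof. by move=> nx; exists (Sub x nx); rewrite SubK. Qed.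

Lemma place_cases x : x != 0 ->
  [\/ place_pos x, place_unit x | place_pos x^-1].
Proof.
move=> /neq0_val[u ->]; rewrite -val_mulgV !place_posE place_unitE valnV.
have [->|n0] := eqVneq (v u) 0; first by constructor 2.
have [le|le] := orP (oab_le_total 0 (v u)).
  by constructor 1; rewrite lt_neqAle eq_sym n0.
by constructor 3; rewrite -(oab_ltD2l _ _ (v u)) addr0 subrr lt_neqAle n0.
Qed.

Lemma place_posM x y : place_pos x -> place_pos y -> place_pos (x * y).
Proof.
move=> /andP[x0 mx] /andP[y0 my]; rewrite /place_pos mulf_neq0 //=.
apply: vmax_mul => //; case: (neq0_val x0) mx => u ->.
by rewrite vmaxE vringE => /ltW.
Qed.

Lemma place_posU x y : place_pos x -> place_unit y -> place_pos (x * y).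
Proof.
move=> /andP[x0 mx] uy; rewrite /place_pos mulf_neq0 ?(place_unit_neq0 uy) //=.
by rewrite mulrC; apply: vmax_mul => //; case/andP: uy.
Qed.

Lemma place_unitM x y : place_unit x -> place_unit y -> place_unit (x * y).
Proof.
move=> ux uy; move: (ux) (uy).
have [u ->] := neq0_val (place_unit_neq0 ux).
have [w ->] := neq0_val (place_unit_neq0 uy).
by rewrite -val_mulgM !place_unitE valnM => /eqP-> /eqP->; rewrite addr0.
Qed.

Lemma place_unitV x : place_unit x -> place_unit x^-1.
Proof.
move=> ux; move: (ux); have [u ->] := neq0_val (place_unit_neq0 ux).
by rewrite -val_mulgV !place_unitE valnV oppr_eq0.
Qed.

Lemma place_unitN1 : place_unit (-1).
Proof. by rewrite -[-1]/(val (mulgN1 F)) place_unitE valnN1. Qed.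

Lemma place_unit_vring x : place_unit x -> x \in vring v.
Proof. by case/andP. Qed.

Lemma place_pos_vring x : place_pos x -> x \in vring v.
Proof.
move=> /andP[x0]; case: (neq0_val x0) => u ->.
by rewrite vmaxE vringE => /ltW.
Qed.

Lemma residueB x y : x \in vring v -> y \in vring v ->
  residue v (x - y) = residue v x - residue v y.
Proof.
move=> hx hy; have hxy : x - y \in vring v by rewrite rpredB.
rewrite (residueE hx) (residueE hy) (residueE hxy) /residue_pi -raddfB.
by congr (\pi_{ideal_quot _} _)%qT; apply: val_inj.
Qed.

Lemma residue_eq0 x : x \in vring v -> (residue v x == 0) = (x \in vmax v).
Proof. by move=> hx; rewrite (residueE hx) residue_pi_eq0. Qed.

Lemma residue_unitM x y : place_unit x -> place_unit y ->
  residue v (x * y) = residue v x * residue v y.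
Proof. by move=> /place_unit_vring ? /place_unit_vring ?; apply: residueM. Qed.

Lemma residue_unit_neq0 x : place_unit x -> residue v x != 0.
Proof.
by move=> ux; rewrite residue_eq0 ?place_unit_vring //; case/andP: ux.
Qed.

Lemma residue_unitV x : place_unit x -> residue v x^-1 = (residue v x)^-1.
Proof.
move=> ux; apply: (mulfI (residue_unit_neq0 ux)).
rewrite (divff (residue_unit_neq0 ux)) -residue_unitM ?place_unitV //.
by rewrite (divff (place_unit_neq0 ux)) residue1.
Qed.

Lemma residueN1 : residue v (-1) = -1.
Proof.
rewrite -sub0r residueB ?vring0 ?vring1 // residue1.
have /eqP-> : residue v 0 == 0 by rewrite residue_eq0 ?vmax0 ?vring0.
exact: sub0r.
Qed.

Lemma place_pos_sub1 x : place_pos x ->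
  place_unit (1 - x) /\ residue v (1 - x) = 1.
Proof.
move=> px; have hx := place_pos_vring px.
have h1x : 1 - x \in vring v by rewrite rpredB ?vring1.
have r1 : residue v (1 - x) = 1.
  rewrite residueB ?vring1 // residue1.
  have /eqP-> : residue v x == 0 by rewrite residue_eq0 //; case/andP: px.
  exact: subr0.
by split=> //; rewrite /place_unit h1x -residue_eq0 // r1 oner_neq0.
Qed.

Lemma place_unit_sub1 x : place_unit x -> x != 1 ->
  (residue v x = 1 /\ place_pos (1 - x)) \/
  [/\ residue v x != 1, place_unit (1 - x) &
      residue v (1 - x) = 1 - residue v x].
Proof.
move=> ux x1; have hx := place_unit_vring ux.
have h1x : 1 - x \in vring v by rewrite rpredB ?vring1.
have r1 : residue v (1 - x) = 1 - residue v x.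
  by rewrite residueB ?vring1 ?residue1.
have [rx|rx] := eqVneq (residue v x) 1; [left|right]; split=> //.
  by rewrite /place_pos subr_eq0 eq_sym x1 -residue_eq0 // r1 rx subrr eqxx.
by rewrite /place_unit h1x -residue_eq0 // r1 subr_eq0 eq_sym.
Qed.

Local Notation K := (resfield v).
Local Notation M := (extF (RPhat K)).

Definition ext_one (m : RPhat K) : M := ext_tensor 1 m.

Fact ext_one_is_zmod_morphism : zmod_morphism ext_one.
Proof.
move=> m n; apply/eqP; rewrite eq_sym subr_eq; apply/eqP.
by rewrite /ext_one /ext_tensor -tensorDr subrK.
Qed.
HB.instance Definition _ :=
  GRing.isZmodMorphism.Build (RPhat K) M ext_one ext_one_is_zmod_morphism.

Lemma sqring_incl_elt (a : valunits v) :
  sqring_incl v (gr_elt (sqc a)) = gr_elt (sqc (valunits_incl a)).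
Proof. exact: etrans (gr_map_elt _ _) (congr1 (@gr_elt _) (sqc_mapE _ _)). Qed.

Lemma sqring_red_elt (a : valunits v) :
  sqring_red v (gr_elt (sqc a)) = gr_elt (sqc (valunits_red a)).
Proof. exact: etrans (gr_map_elt _ _) (congr1 (@gr_elt _) (sqc_mapE _ _)). Qed.

Lemma scale_ext_one (r : sqring F) (m : RPhat K) :
  r *: ext_one m = ext_tensor r m.
Proof.
rewrite /ext_one /ext_tensor.
by apply: etrans (scale_tensor (sqring_incl v) _ _ _) _; rewrite mulr1.
Qed.

Lemma ext_one_scale (r : valunits_sqring v) (m : RPhat K) :
  sqring_incl v r *: ext_one m = ext_one (sqring_red v r *: m).
Proof.
rewrite scale_ext_one /ext_one /ext_tensor.
by rewrite -[sqring_incl v r]mul1r tensorA.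
Qed.

(** The class of a unit moves through the tensor product and becomes the class
    of its residue. *)
Lemma ext_one_act x (m : RPhat K) : place_unit x ->
  sqcl x *: ext_one m = ext_one (sqcl (residue v x) *: m).
Proof.
move=> ux; have x0 := place_unit_neq0 ux; have r0 := residue_unit_neq0 ux.
have vx : (Sub x x0 : mulgrp F) \in vunit v.
  by rewrite unfold_in -place_unitE SubK.
pose a : valunits v := Sub (Sub x x0) vx.
rewrite (sqclE x0) (sqclE r0).
have -> : gr_elt (sqc (Sub x x0 : mulgrp F)) = sqring_incl v (gr_elt (sqc a)).
  by rewrite sqring_incl_elt; congr (gr_elt (sqc _)).
have -> : gr_elt (sqc (Sub (residue v x) r0 : mulgrp K)) =
    sqring_red v (gr_elt (sqc a)).
  rewrite sqring_red_elt; congr (gr_elt (sqc _)).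
  exact: val_inj.
exact: ext_one_scale.
Qed.

End Place.

(** * The specialization map and its surjectivity *)

Lemma sqc_map_surj (A B : comGroupType) (f : UMagmaMorphism.type A B) :
  (forall b, exists a, f a = b) -> forall t, exists s, sqc_map f s = t.
Proof.
move=> fs; elim/sqc_ind=> b; have [a <-] := fs b.
by exists (sqc a); rewrite sqc_mapE.
Qed.

Lemma gr_map_surj (A B : comGroupType) (f : UMagmaMorphism.type A B) :
  (forall b, exists a, f a = b) -> forall r, exists s, gr_map f s = r.
Proof.
move=> fs; elim/malg_ind=> [|c b|r1 r2 [s1 E1] [s2 E2]].
- by exists 0; rewrite raddf0.
- have [a <-] := fs b; exists << c *g a >>.
  by rewrite /gr_map flinU malgZU mulr1.
- by exists (s1 + s2); rewrite -E1 -E2; exact: raddfD.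
Qed.

Section Specialization.
Context (F : fieldType) (G : orderedAbType) (v : valuation F G).
Local Notation K := (resfield v).
Local Notation M := (extF (RPhat K)).
Implicit Types (x y : F).

Definition special_value x : RPhat K :=
  if place_unit v x then hat_symb (residue v x)
  else if place_pos v x then hat_const K else - hat_const K.

Lemma special_value_unit x : place_unit v x ->
  special_value x = hat_symb (residue v x).
Proof. by rewrite /special_value => ->. Qed.

Lemma special_value_pos x : place_pos v x -> special_value x = hat_const K.
Proof.
move=> px; rewrite /special_value px ifF //.
by apply/negP => /andP[_ /negP[]]; case/andP: px.
Qed.

Lemma special_value_neg x : place_pos v x^-1 -> special_value x = - hat_const K.
Proof.
move=> nx; have x0 : x != 0 by rewrite -invr_eq0 (place_pos_neq0 nx).
rewrite /special_value ifF ?ifF //.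
  apply/negP => px; have := place_posM px nx; rewrite divff //.
  by rewrite /place_pos -[1]/(val (1%g : mulgrp F)) vmax_unit ?valn1 ?andbF.
apply/negP => /place_unitV/andP[_ /negP[]].
by case/andP: nx.
Qed.

(** The generator None only survives when F has two elements.  Its value then is
    what makes the map surjective, and it is annihilated by 3. *)
Definition special_gen (o : option (mulgrp F)) : M :=
  if o is Some u then ext_one (special_value (val u))
  else if pselect (card_is F 2) then ext_one (hat_const K) else 0.

Local Notation fS := (flin special_gen).

Lemma special_fsymb x : x != 0 -> fS (fsymb x) = ext_one (special_value x).
Proof.
move=> x0; rewrite /fsymb insubT.
by apply: etrans (flinU _ _ _) _; rewrite scale1r.
Qed.

Lemma special_none : fS << None >> = special_gen None.
Proof. exact: etrans (flinU _ _ _) (scale1r _). Qed.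

Lemma special_gen_five_term x y : x != 0 -> x != 1 -> y != 0 -> y != 1 ->
  fS (five_term x y) = 0.
Proof.
move=> x0 x1 y0 y1.
have nz1 (z : F) : z != 1 -> 1 - z != 0 by rewrite subr_eq0 eq_sym.
have nV (z : F) : z != 0 -> z^-1 != 0 by rewrite invr_eq0.
have nV1 (z : F) : z != 1 -> z^-1 != 1 by rewrite invr_eq1.
apply: etrans (linear_five_term (f := fS) _ _ _ (special_fsymb x0)
  (special_fsymb y0) (special_fsymb _) (special_fsymb _) (special_fsymb _)) _.
- by apply: mulf_neq0 => //; apply: nV.
- by apply: mulf_neq0; [|apply: nV]; apply/nz1/nV1.
- by apply: mulf_neq0; [|apply: nV]; apply/nz1.
apply: (specialization_five_term (j := @ext_one F G v)
  (@sqclM F) (@sqcl_sqr F) (@sqclM K) (@sqcl_sqr K)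
  (@ext_one_act F G v) (@place_pos_neq0 F G v) (@place_unit_neq0 F G v)
  (@place_cases F G v) (@place_posM F G v) (@place_posU F G v)
  (@place_unitM F G v) (@place_unitV F G v) (@place_unitN1 F G v)
  (@residue_unitM F G v) (@residue_unitV F G v) (@residue_unit_neq0 F G v)
  (@residueN1 F G v) (@place_pos_sub1 F G v) (@place_unit_sub1 F G v)
  (@hat_symb1 K) (@hat_symbV_psi1 K) (@hat_symbV_psi2 K) (@hat_five_term K)
  (@hat_constE K) (@hat_const3 K) (@hat_const_stable K)
  special_value_pos special_value_neg special_value_unit x0 x1 y0 y1).
Qed.

Lemma special_gen_RP_rel g : RP_rel g -> fS g = 0.
Proof.
case=> [|F4 x y|F3|F2|F2].
- apply: etrans (special_fsymb (oner_neq0 F)) _.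
  have u1 : place_unit v 1.
    by rewrite -[1]/(val (1%g : mulgrp F)) place_unitE valn1.
  by rewrite special_value_unit // residue1 hat_symb1 raddf0.
- exact: special_gen_five_term.
- pose m := fsymb (-1 : F) + sqcl (-1) *: fsymb (-1).
  suff m0 : fS m = 0.
    apply: etrans (raddfMn fS _ m) _.
    by apply: etrans (congr1 (fun n => n *+ 2) m0) _; apply: mul0rn.
  (* The value is 1 (x) psi_1(-1), which is already 0 before doubling. *)
  have E := special_fsymb (N1_neq0 F).
  apply: etrans (raddfD fS _ _) _.
  apply: etrans (congr1 (fun m => _ + m) (linearZ _ _)) _.
  apply: etrans (congr2 (fun m n => m + sqcl (-1) *: n) E E) _.
  have uN := place_unitN1 v.
  rewrite (special_value_unit uN) (ext_one_act _ uN) residueN1 -raddfD.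
  have := hat_symbV_psi1 (N1_neq0 K); rewrite invrN1 => /eqP.
  by rewrite -addr_eq0 => /eqP->; rewrite raddf0.
- apply: etrans (raddfMn fS _ _) _.
  apply: etrans (congr1 (fun m => m *+ 3) special_none) _.
  rewrite /special_gen; case: (pselect (card_is F 2)) => [F2'|//] /=.
  by rewrite -raddfMn hat_const3 raddf0.
- apply: etrans special_none _.
  by rewrite /special_gen; case: (pselect (card_is F 2)) => [//|F2'].
Qed.

Lemma valunits_red_surj (w : mulgrp K) :
  exists a : valunits v, valunits_red a = w.
Proof.
have [x Ex] : exists x : valring v, residue_pi x = val w.
  by move: (val w); apply: residue_pi_ind => x; exists x.
have /residue_pi_unit[u xu vu] : residue_pi x != 0 by rewrite Ex (valP w).
have hu : u \in vunit v by rewrite unfold_in vu.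
exists (Sub u hu); apply: val_inj; rewrite -Ex /=.
rewrite -xu (residueE (valP x)); congr residue_pi.
exact: val_inj.
Qed.

Lemma sqring_red_surj (r : sqring K) : exists s, sqring_red v s = r.
Proof. exact: gr_map_surj (sqc_map_surj valunits_red_surj) r. Qed.

(** Every x other than 0 is a unit with residue 1; if x were not 1, the same
    would hold for 1 - x, whose residue is 0. *)
Lemma trivial_val_card2 : card_is K 2 -> (forall u, v u = 0) -> card_is F 2.
Proof.
move=> K2 v0; have u2 : uniq [:: 0 : F; 1] by rewrite /= inE eq_sym oner_neq0.
apply: (card_is_uniq u2) => x; rewrite !inE; apply: contraT.
rewrite negb_or => /andP[x0 x1].
have unit_all z : z != 0 -> place_unit v z.
  by move=> /neq0_val[u ->]; rewrite place_unitE v0.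
have ux := unit_all x x0; have u1x : place_unit v (1 - x).
  by apply: unit_all; rewrite subr_eq0 eq_sym.
have := residue_unit_neq0 u1x.
rewrite residueB ?vring1 ?place_unit_vring // residue1.
by rewrite (card_is2P K2 (residue_unit_neq0 ux)) subrr eqxx.
Qed.

Section Surjectivity.
Context (S : {linear RP F -> M}).
Context (S_gen : forall o, S (quotmod_pi (@RP_rel F) << o >>) = special_gen o).

Lemma specialization_symb x : x != 0 -> S (symb x) = ext_one (special_value x).
Proof.
move=> x0; rewrite /symb /fsymb insubT.
exact: S_gen (Some (Sub x x0)).
Qed.

(** Either some element is not a unit and its symbol is sent to C or -C, or the
    valuation is trivial and the generator None is available. *)
Lemma ext_hat_const_image :
  card_is K 2 -> exists p, S p = ext_one (hat_const K).
Proof.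
move=> K2; have [[u v0]|v0] := pselect (exists u, v u != 0).
  have [pu|uu|nu] := place_cases v (valP u).
  - exists (symb (val u)); apply: etrans (specialization_symb (valP u)) _.
    by rewrite (special_value_pos pu).
  - by rewrite place_unitE (negPf v0) in uu.
  - exists (- symb (val u)); apply: etrans (raddfN S _) _.
    apply: etrans (congr1 -%R (specialization_symb (valP u))) _.
    by rewrite (special_value_neg nu) raddfN opprK.
have F2 : card_is F 2.
  apply: trivial_val_card2 K2 _ => u; apply/eqP; apply: contraT => vu.
  by case: v0; exists u.
exists (quotmod_pi (@RP_rel F) << None >>).
apply: etrans (S_gen None) _; rewrite /special_gen.
by case: (pselect (card_is F 2)).
Qed.

Lemma specialization_surj_one (n : RPhat K) : exists p, S p = ext_one n.
Proof.
have hgen (o : option (mulgrp K)) :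
    exists p, S p = ext_one (RPhat_pi K (quotmod_pi (@RP_rel K) << o >>)).
  case: o => [w|].
    have [a aw] := valunits_red_surj w.
    have ua : place_unit v (val (val a)).
      by rewrite place_unitE; exact: (valP a).
    have wE : residue v (val (val a)) = val w by rewrite -aw.
    exists (symb (val (val a))).
    apply: etrans (specialization_symb (valP (val a))) _.
    by rewrite (special_value_unit ua) wE /hat_symb /symb /fsymb valK.
  have [K2|K2] := pselect (card_is K 2).
    have [p Sp] := ext_hat_const_image K2; exists p.
    by rewrite -/(hat_none K) -(hat_const_card2 K2).
  by exists 0; rewrite -/(hat_none K) (hat_none0 K2) !raddf0.
elim/quotmod_ind: n; elim/quotmod_ind; elim/malg_ind=> [|c o|g h [p Sp] [q Sq]].
- by exists 0; rewrite !raddf0.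
- have [r rc] := sqring_red_surj c; have [p Sp] := hgen o.
  exists (sqring_incl v r *: p).
  apply: etrans (linearZ _ _) _; apply: etrans (congr1 ( *:%R _) Sp) _.
  apply: etrans (ext_one_scale _ _) _; rewrite rc; congr ext_one.
  have -> : << c *g o >> = c *: (<< o >> : {malg (sqring K)[_]}).
    by rewrite malgZU mulr1.
  apply: esym; apply: etrans (congr1 (RPhat_pi K) (linearZ _ _)) _.
  exact: linearZ.
- exists (p + q); apply: etrans (raddfD S _ _) _.
  apply: etrans (congr2 +%R Sp Sq) _.
  apply: etrans (esym (raddfD (@ext_one F G v) _ _)) _.
  apply: (congr1 (@ext_one F G v)).
  apply: etrans (esym (raddfD (RPhat_pi K) _ _)) (congr1 (RPhat_pi K) _).
  exact: esym (raddfD _ _ _).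
Qed.

Lemma specialization_surj (t : M) : exists p, S p = t.
Proof.
elim/tens_ind: t => [|r n|t u [p Sp] [q Sq]].
- by exists 0; rewrite raddf0.
- have [p Sp] := specialization_surj_one n; exists (r *: p).
  apply: etrans (linearZ _ _) _; apply: etrans (congr1 ( *:%R _) Sp) _.
  exact: scale_ext_one.
- by exists (p + q); apply: etrans (raddfD S _ _) (congr2 +%R Sp Sq).
Qed.
End Surjectivity.
End Specialization.

Theorem theorem4p9 (F : fieldType) (Gamma : orderedAbType)
    (v : valuation F Gamma) :
  exists S : {linear RP F -> extF (RPhat (resfield v))},
    (forall t : extF (RPhat (resfield v)), exists p : RP F, S p = t) /\
    (forall a : mulgrp F,
      [/\ v a = 0 ->
            S (symb (val a)) =
              ext_tensor 1 (RPhat_pi (resfield v) (symb (residue v (val a)))),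
          0 < v a ->
            S (symb (val a)) =
              ext_tensor 1 (RPhat_pi (resfield v) (bloch_const (resfield v)))
        & v a < 0 ->
            S (symb (val a)) =
              - ext_tensor 1
                  (RPhat_pi (resfield v) (bloch_const (resfield v)))]).
Proof.
have [S SE] := quotmod_lift (@special_gen_RP_rel F Gamma v).
have S_gen o : S (quotmod_pi (@RP_rel F) << o >>) = special_gen v o.
  by apply: etrans (SE _) _; apply: etrans (flinU _ _ _) (scale1r _).
exists S; split; first exact: specialization_surj.
move=> a; have Sa := specialization_symb S_gen (valP a).
split=> va; apply: (etrans Sa).
- have ua : place_unit v (val a) by rewrite place_unitE va.
  by rewrite (special_value_unit ua); reflexivity.
- have pa : place_pos v (val a) by rewrite place_posE.
  by rewrite (special_value_pos pa); reflexivity.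
- have na : place_pos v (val a)^-1.
    by rewrite -val_mulgV place_posE valnV -(oab_ltD2l _ _ (v a)) addr0 subrr.
  by rewrite (special_value_neg na) raddfN; reflexivity.
Qed.
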